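(* Let $d\geq 1$. There exists a constant $C = C(d)$ such that for every integer $n\geq 1$ and every probability measure $\tau$ on the sphere $S^d\subset\mathbb{R}^{d+1}$, there exists a probability measure $\tau'$ on $S^d$ supported on (at most) $n$ points such that \[ \sup_{x\in S^d}\left|\int_{S^d}|x\cdot y|\,d\tau(y) - \int_{S^d}|x\cdot y|\,d\tau'(y)\right| \leq C n^{-\frac{1}{2}-\frac{3}{2d}}. \]
   Context: $S^d=\{x\in\mathbb{R}^{d+1}:|x|=1\}$ is the unit sphere of dimension $d$, and $x\cdot y$ is the Euclidean inner product. *)

(* Defs.v *)
From HB Require Import structures.
From mathcomp Require Import all_boot all_order all_algebra.
From mathcomp Require Import all_classical all_reals all_analysis.
Set Implicit Arguments. Unset Strict Implicit. Unset Printing Implicit Defensive.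
Import Order.TTheory GRing.Theory Num.Theory.
Local Open Scope classical_set_scope.
Local Open Scope ring_scope.

Definition vec (R : realType) (d : nat) : normedModType R := 'rV[R]_(d.+1).

Definition dotp (R : realType) (d : nat) (x y : vec R d) : R :=
  \sum_(i < d.+1) x ord0 i * y ord0 i.

Definition sphere (R : realType) (d : nat) : set (vec R d) :=
  [set x | dotp x x = 1].

Definition borelR (R : realType) (d : nat) :=
  g_sigma_algebraType (@open (vec R d)).

Arguments sphere : clear implicits.
Arguments borelR : clear implicits.

(* Main.v *)
Require Import Defs.
From HB Require Import structures.
From mathcomp Require Import all_boot all_order all_algebra ring lra zify.
From mathcomp Require Import finmap all_classical all_reals all_analysis.
From mathcomp Require Import measurable_realfun.
Set Implicit Arguments. Unset Strict Implicit. Unset Printing Implicit Defensive.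
Import Order.TTheory GRing.Theory Num.Theory.
Import numFieldNormedType.Exports.

(** A measure with [N] atoms is replaced by one with at most [7N/8] atoms at
    the cost [C N^(-1/2-3/(2d))]; iterating, the costs form a geometric series
    dominated by its last term.  Only the (at least [N/2]) atoms of weight at
    most [2/N] are touched: their weights [w_i] are multiplied by [1 + c_i], for
    a partial colouring [c] with values in [-1,1] and many entries equal to
    [-1].

    The colouring must make [F(x) = sum_i c_i w_i |x.y_i|] small on the whole
    sphere.  Put [G(x) = sum_i c_i w_i sgn(x.y_i) y_i], so that
    [F(x) = x.G(x)].  In the affine charts [x_c = 1], which the hyperplanes
    [y_i^perp] cut into cells, choose for each [k] a [4^k]-net for the distance
    counting the separating hyperplanes, where auxiliary coordinate hyperplanes
    are added so that it also dominates the Euclidean distance.  By Haussler's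
    packing lemma the nets have [O((N/4^k)^d)] points, without a logarithm.
    Chaining through the nets, [G] is made to vanish exactly on the coarsest
    one ([4^k] about [N^(1-1/d)]), and the increment from level [k] to [k + 1]
    involves [O(4^k)] atoms, each contributing [O(4^k/N)], hence a vector of
    norm [O(8^k/N)].  The partial colouring lemma bounds all these increments
    simultaneously, with a loss that is only linear in the number of levels
    above [k].

    The partial colouring is a minimiser, over the polytope of all the required
    bounds, of a sum of hyperbolic cosines minus the squared norm: were few
    coordinates equal to [1] or [-1], the second order condition would fail in
    some direction orthogonal to all the active constraints. *)

(** * Set systems of bounded VC dimension and Haussler's packing lemma *)

Definition shatters (I : finType) (w : {set I} -> nat) (T : {set I}) :=
  forall T' : {set I}, T' \subset T -> exists2 p, 0 < w p & p :&: T = T'.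

(** Compression along one direction does not lower the edge weight in another: for a sum of two
    minima it is best to pair the larger values together and the smaller ones together. *)
Lemma minn_rearrange a b a' b' :
  minn a a' + minn b b' <=
  minn (maxn a b) (maxn a' b') + minn (minn a b) (minn a' b').
Proof. lia. Qed.

Lemma sum_set_split (I : finType) (j : I) (F : {set I} -> nat) :
  \sum_p F p = \sum_(p : {set I} | j \notin p) (F p + F (j |: p)).
Proof.
rewrite (bigID (fun p : {set I} => j \notin p)) /= big_split /=; congr addn.
rewrite (reindex_onto (fun p => j |: p) (fun p => p :\ j)) /=; last first.
  by move=> p; rewrite negbK => jp; rewrite finset.setD1K.
apply: eq_bigl => p; rewrite !inE eqxx /=.
apply/eqP/idP => [<-|jp]; first by rewrite !inE eqxx.
by rewrite finset.setU1K.
Qed.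

(* A class of VC dimension [d] has at most [d] times as many edges as vertices
   in its unit-distance graph; this is the weighted form, with Sauer's bound.
   Removing a direction [j], [w] is replaced by the maximum and the minimum of
   [w p] and [w (j |: p)]; a set shattered by the minimum stays shattered by [w]
   after adding [j]. *)
Lemma weighted_edge_bound (I : finType) (S : {set I}) (d : nat) (w : {set I} -> nat) :
  (forall p, 0 < w p -> p \subset S) ->
  (forall T : {set I}, #|T| = d -> ~ shatters w T) ->
  \sum_(j in S) \sum_(p : {set I} | j \notin p) minn (w p) (w (j |: p))
    + \sum_p w p <= d * \sum_p w p
  /\ #|[set p | 0 < w p]| <= (if d is d'.+1 then #|S|.+1 ^ d' else 0).
Proof.
move: {2}#|S| (erefl #|S|) => n; elim: n S d w => [|n IH] S d w.
  move/eqP; rewrite cards_eq0 => /eqP -> wS wd.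
  rewrite big_set0 add0n cards0.
  have w0 p : p != finset.set0 -> w p = 0.
    move=> p0; apply/eqP; rewrite -leqn0 leqNgt; apply/negP => /wS.
    by rewrite finset.subset0 (negbTE p0).
  have dw : 0 < w finset.set0 -> 0 < d.
    move=> hw; rewrite lt0n; apply/eqP => d0.
    apply: (wd finset.set0); first by rewrite cards0.
    move=> T'; rewrite finset.subset0 => /eqP ->; exists finset.set0 => //.
    by rewrite finset.setI0.
  rewrite (bigD1 finset.set0) //= big1 => [|p /w0 //]; rewrite addn0; split.
    by case: (posnP (w finset.set0)) => [->|/dw]; [rewrite muln0|exact: leq_pmull].
  case: (posnP (w finset.set0)) => [hw|hw].
    rewrite (_ : [set p | _] = finset.set0) ?cards0 //; apply/finset.setP => p; rewrite !inE.
    by case: (eqVneq p finset.set0) => [->|/w0 ->]; rewrite ?hw.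
  have := dw hw; case: d {wd dw} => // d _; rewrite exp1n.
  apply: leq_trans (_ : #|[set (finset.set0 : {set I})]| <= _); last by rewrite cards1.
  apply/fintype.subset_leq_card/fintype.subsetP => p; rewrite !inE.
  by apply: contraTT => /w0 ->.
move=> cS wS wd.
have /card_gt0P[j0 j0S] : 0 < #|S| by rewrite cS.
have cS' : #|S :\ j0| = n.
  by move: cS; rewrite (cardsD1 j0) j0S add1n => -[].
pose w1 (p : {set I}) := if j0 \in p then 0 else maxn (w p) (w (j0 |: p)).
pose w2 (p : {set I}) := if j0 \in p then 0 else minn (w p) (w (j0 |: p)).
have sub p : 0 < maxn (w p) (w (j0 |: p)) -> j0 \notin p -> p \subset S :\ j0.
  move=> wp jp; rewrite subsetD1 jp andbT.
  case: (posnP (w p)) => [wp0|/wS //]; move: wp; rewrite wp0 max0n => /wS.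
  by apply: fintype.subset_trans; exact: finset.subsetUr.
have w1S p : 0 < w1 p -> p \subset S :\ j0.
  by rewrite /w1; case: ifPn => // jp wp; exact: sub.
have w2S p : 0 < w2 p -> p \subset S :\ j0.
  by rewrite /w2; case: ifPn => // jp wp; apply: sub => //; lia.
have w12 : \sum_p w p = \sum_p w1 p + \sum_p w2 p.
  rewrite (sum_set_split j0) -big_split /= big_mkcond /=; apply: eq_bigr => p _.
  by rewrite /w1 /w2; case: ifPn; case: ifPn => //; lia.
have sh1 T : shatters w1 T -> shatters w T.
  move=> h T' T'T; have [p wp pT] := h T' T'T.
  have jT : j0 \notin T.
    have [q wq qT] := h T (fintype.subxx _).
    have := w1S _ wq; rewrite subsetD1 => /andP[_]; apply: contra.
    by rewrite -qT !inE => /andP[].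
  move: wp; rewrite /w1; case: ifPn => // jp.
  case: (posnP (w p)) => [->|wp _]; last by exists p.
  rewrite max0n => wp; exists (j0 |: p) => //.
  rewrite finset.setIUl pT; apply/finset.setP => x; rewrite !inE.
  by case: eqVneq => [->|] //=; rewrite (negbTE jT).
have sh2 T : shatters w2 T -> j0 \notin T /\ shatters w (j0 |: T).
  move=> h.
  have jT : j0 \notin T.
    have [q wq qT] := h T (fintype.subxx _).
    have := w2S _ wq; rewrite subsetD1 => /andP[_]; apply: contra.
    by rewrite -qT !inE => /andP[].
  split => // T' T'T.
  have [|p wp pT] := h (T' :\ j0).
    by rewrite subDset.
  move: wp; rewrite /w2; case: ifPn => // jp wp.
  have pTE x : x != j0 -> (x \in p) && (x \in T) = (x \in T').
    by move=> xj; move/finset.setP/(_ x): pT; rewrite !inE xj.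
  case: (boolP (j0 \in T')) => jT'.
    exists (j0 |: p); first lia.
    apply/finset.setP => x; rewrite !inE; case: eqVneq => [->|xj] /=; first by rewrite jT'.
    exact: pTE.
  exists p; first lia.
  apply/finset.setP => x; rewrite !inE; case: eqVneq => [->|xj] /=.
    by rewrite (negbTE jp) (negbTE jT').
  exact: pTE.
have /IH : #|S :\ j0| = n by [].
move=> IH'.
have [|e1 s1] := IH' d w1 w1S; first by move=> T cT /sh1; exact: wd.
have s12 : #|[set p | 0 < w p]| = #|[set p | 0 < w1 p]| + #|[set p | 0 < w2 p]|.
  have cE (u : {set I} -> nat) : #|[set p | 0 < u p]| = \sum_p (0 < u p : nat).
    by rewrite -sum1_card big_mkcond /=; apply: eq_bigr => p _; rewrite inE; case: ltnP.
  rewrite !cE (sum_set_split j0) -big_split /= big_mkcond /=; apply: eq_bigr => p _.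
  by rewrite /w1 /w2; case: ifPn; case: ifPn => //; lia.
(* The edges in direction [j0] weigh exactly the total of [w2]; those in a direction [j] are
   compared by rearrangement on the squares spanned by [j0] and [j]. *)
have EE : \sum_(j in S) \sum_(p : {set I} | j \notin p) minn (w p) (w (j |: p))
  <= \sum_p w2 p +
     (\sum_(j in S :\ j0) \sum_(p : {set I} | j \notin p) minn (w1 p) (w1 (j |: p))
     + \sum_(j in S :\ j0) \sum_(p : {set I} | j \notin p) minn (w2 p) (w2 (j |: p))).
  rewrite (big_setD1 j0) //=; apply: leq_add.
    rewrite big_mkcond /=; apply: leq_sum => p _.
    by rewrite /w2; case: (j0 \in p).
  rewrite -big_split /=; apply: leq_sum => j; rewrite !inE => /andP[jj0 jS].
  rewrite -big_split /= big_mkcond [X in _ <= X]big_mkcond /=.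
  rewrite (sum_set_split j0) big_mkcond /=; apply: leq_sum => p _.
  case: (boolP (j0 \in p)) => //= jp; rewrite !inE (negbTE jj0) /=.
  case: (boolP (j \in p)) => //= j1p.
  rewrite /w1 /w2 !inE [j0 == j]eq_sym (negbTE jj0) /= (negbTE jp) /=.
  by rewrite finset.setUCA; exact: minn_rearrange.
case: d wd e1 s1 => [|d] wd e1 s1.
  have w0 p : w p = 0.
    apply/eqP; rewrite -leqn0 leqNgt; apply/negP => wp.
    apply: (wd finset.set0); first by rewrite cards0.
    move=> T'; rewrite finset.subset0 => /eqP ->; exists p => //.
    by rewrite finset.setI0.
  rewrite !big1 // => [|j _]; last by apply: big1 => p _; rewrite !w0.
  rewrite (_ : [set p | _] = finset.set0) ?cards0 //; apply/finset.setP => p.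
  by rewrite !inE w0.
(* The size of the excluded shattered sets drops by one for [w2]. This saves one total of [w2],
   which pays for the edges in direction [j0]. *)
have [|e2 s2] := IH' d w2 w2S.
  move=> T cT /sh2 [jT]; apply: wd; by rewrite cardsU1 jT cT.
split; first by rewrite w12; lia.
rewrite s12 cS; apply: leq_trans (leq_add s1 s2) _; rewrite cS'.
case: d {IH' e1 e2 s1 s2 wd} => [|d]; first by rewrite !expn0.
have hd : n.+1 ^ d <= n.+2 ^ d by case: (d) => // k; rewrite leq_exp2r.
by rewrite [X in _ <= X]expnS mulSn addnC leq_add // expnS leq_mul.
Qed.

(** Double counting of separated pairs: if [x] splits [C] into parts of sizes [a] and [b], it
    separates [2ab] ordered pairs, and [ab <= #|C| * minn a b]. *)
Lemma split_lower_bound (T X : finType) (f : T -> X -> bool) (D : nat) (C : {set T}) :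
  (forall t t', t != t' -> D <= #|[set x | f t x != f t' x]|) ->
  (#|C| - 1) * D <=
  2 * \sum_x minn #|[set t in C | ~~ f t x]| #|[set t in C | f t x]|.
Proof.
move=> sep; case: (posnP #|C|) => [->//|C0].
rewrite -(leq_pmul2l C0).
have h1 : #|C| * ((#|C| - 1) * D) <=
    \sum_(t in C) \sum_(t' in C) #|[set x | f t x != f t' x]|.
  rewrite -sum_nat_const; apply: leq_sum => t tC.
  rewrite (big_setD1 t) //= -[X in X <= _]add0n leq_add //.
  rewrite (_ : #|C| - 1 = #|C :\ t|); last by rewrite (cardsD1 t C) tC add1n subn1.
  rewrite -sum_nat_const; apply: leq_sum => t'; rewrite !inE => /andP[tt' _].
  by apply: sep; rewrite eq_sym.
apply: leq_trans h1 _.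
have -> : \sum_(t in C) \sum_(t' in C) #|[set x | f t x != f t' x]| =
   \sum_x \sum_(t in C) \sum_(t' in C) (f t x != f t' x : nat).
  under eq_bigr => t _.
    under eq_bigr => t' _.
      rewrite -sum1_card big_mkcond /=.
      under eq_bigr => x _ do rewrite inE.
      over.
    rewrite exchange_big /=; over.
  by rewrite exchange_big; apply: eq_bigr => x _; apply: eq_bigr => t _;
    apply: eq_bigr => t' _; case: (_ != _).
rewrite mulnCA !big_distrr /=; apply: leq_sum => x _.
set A0 := [set t in C | ~~ f t x]; set A1 := [set t in C | f t x].
have cardE (P : pred T) : #|[set t in C | P t]| = \sum_(t in C) (P t : nat).
  rewrite -sum1_card (eq_bigl (fun t => (t \in C) && P t)) => [|t]; last by rewrite inE.
  by rewrite big_mkcondr; apply: eq_bigr => t _; case: (P t).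
have cC : #|C| = #|A0| + #|A1|.
  rewrite !cardE -big_split -sum1_card /=; apply: eq_bigr => t _.
  by case: (f t x).
apply: (@leq_trans (2 * (#|A0| * #|A1|))); last by rewrite cC; nia.
have -> : \sum_(t in C) \sum_(t' in C) (f t x != f t' x : nat) =
   \sum_(t in C) (~~ f t x * #|A1| + f t x * #|A0|).
  apply: eq_bigr => t _; case: (f t x); rewrite ?mul0n ?mul1n ?add0n ?addn0 /A0 /A1 cardE.
    by apply: eq_bigr => t' _; case: (f t' x).
  by apply: eq_bigr => t' _; case: (f t' x).
rewrite big_split /= -!big_distrl /= -(cardE (fun t => ~~ f t x)).
by rewrite -(cardE (fun t => f t x)) -/A0 -/A1 [X in _ + X]mulnC addnn mul2n.
Qed.

(* Chazelle's argument: for a random sequence [a] of [s] elements of [X], count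
   in two ways the weighted edges [E a j] of the traces on [a] in direction
   [j]: at most [d |T|] in total by [weighted_edge_bound], and many of them by
   [split_lower_bound] because resampling [a j] is likely to separate [T]. *)
Theorem haussler_packing (T X : finType) (f : T -> X -> bool) (d D s : nat) :
  0 < d -> 0 < #|X| ->
  (forall g : 'I_d.+1 -> X, exists b : 'I_d.+1 -> bool,
     forall t, exists i, f t (g i) != b i) ->
  (forall t t', t != t' -> D <= #|[set x | f t x != f t' x]|) ->
  4 * d * #|X| <= s * D -> #|T| <= 2 * s.+1 ^ d.
Proof.
move=> d0 X0 vc sep sD.
pose pat (a : {ffun 'I_s -> X}) t := [set i | f t (a i)].
pose w a p := #|[set t | pat a t == p]|.
pose upd (a : {ffun 'I_s -> X}) j x := [ffun i => if i == j then x else a i].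
pose E a j := \sum_(p : {set 'I_s} | j \notin p) minn (w a p) (w a (j |: p)).
have wsum a : \sum_p w a p = #|T|.
  rewrite -sum1_card (partition_big (pat a) predT) //=; apply: eq_bigr => p _.
  by rewrite /w -sum1_card; apply: eq_bigl => t; rewrite inE.
have shat a (U : {set 'I_s}) : #|U| = d.+1 -> ~ shatters (w a) U.
  move=> cU sh; have [b bP] := vc (fun i => a (enum_val (cast_ord (esym cU) i))).
  have [|p] := sh [set u in U | [exists i, (u == enum_val (cast_ord (esym cU) i)) && b i]].
    by apply/fintype.subsetP => u; rewrite inE => /andP[].
  move=> /card_gt0P[t]; rewrite inE => /eqP <- patU.
  have [i /negP[]] := bP t; apply/eqP.
  move/finset.setP/(_ (enum_val (cast_ord (esym cU) i))): patU.
  rewrite !inE enum_valP andbT /= => ->.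
  apply/existsP/idP => [[i' /andP[/eqP /enum_val_inj /cast_ord_inj -> //]]|bi].
  by exists i; rewrite eqxx.
have up a : \sum_j E a j <= d * #|T| /\ #|[set p | 0 < w a p]| <= s.+1 ^ d.
  have [] := @weighted_edge_bound _ [set: 'I_s] d.+1 (w a) _ (shat a).
    by move=> p _; apply: finset.subsetT.
  rewrite wsum cardsT card_ord mulSn addnC leq_add2l => h1 h2; split => //.
  by apply: leq_trans h1; apply: eq_leq; apply: eq_bigl => j; rewrite inE.
(* The class [C p] gathers the [t] with the same trace [p] away from [j]. At most [s.+1 ^ d] classes
   are nonempty, by Sauer's bound, and a fresh [x] at place [j] splits each of them according to
   [f t x]. *)
have low a j : (#|T| - s.+1 ^ d) * D <= 2 * \sum_x E (upd a j x) j.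
  pose C p := [set t | pat a t :\ j == p].
  have wC x (p : {set 'I_s}) : j \notin p ->
     (w (upd a j x) p = #|[set t in C p | ~~ f t x]|) *
     (w (upd a j x) (j |: p) = #|[set t in C p | f t x]|).
    move=> jp.
    have updE t i : (i \in pat (upd a j x) t) = if i == j then f t x else i \in pat a t.
      by rewrite !inE ffunE; case: eqP.
    split; apply: eq_card => t; rewrite !inE.
      apply/eqP/andP => [h|[/eqP <- ftx]]; last first.
        apply/finset.setP => i; rewrite updE !inE; case: eqP => //= _.
        exact/negbTE.
      split; last by move: jp; rewrite -h updE eqxx.
      apply/eqP/finset.setP => i; rewrite -h in_setD1 updE.
      by case: eqP => //= ij; move/finset.setP/(_ i): h; rewrite updE ij eqxx (negbTE jp) => ->.
    apply/eqP/andP => [h|[/eqP <- ftx]]; last first.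
      by apply/finset.setP => i; rewrite updE !inE; case: eqP => //=.
    have hh (i : 'I_s) : (i \in pat (upd a j x) t) = (i \in j |: p) by rewrite h.
    split; last by move: (hh j); rewrite updE eqxx !inE eqxx.
    apply/eqP/finset.setP => i; rewrite in_setD1; move: (hh i); rewrite updE !inE.
    by case: eqP => //= ->; rewrite (negbTE jp).
  have -> : \sum_x E (upd a j x) j = \sum_(p : {set 'I_s} | j \notin p)
     \sum_x minn #|[set t in C p | ~~ f t x]| #|[set t in C p | f t x]|.
    rewrite exchange_big /=; apply: eq_bigr => p jp; apply: eq_bigr => x _.
    by have [-> ->] := wC x p jp.
  rewrite big_distrr /=.
  apply: (@leq_trans (\sum_(p : {set 'I_s} | j \notin p) (#|C p| - 1) * D)); last first.
    by apply: leq_sum => p _; exact: split_lower_bound.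
  rewrite -big_distrl /= leq_mul2r; apply/orP; right.
  rewrite leq_subLR.
  have -> : #|T| = \sum_(p : {set 'I_s} | j \notin p) #|C p|.
    rewrite -sum1_card (partition_big (fun t => pat a t :\ j) (fun p => j \notin p)) /=.
      by apply: eq_bigr => p _; rewrite -sum1_card; apply: eq_bigl => t; rewrite inE.
    by move=> t _; rewrite !inE eqxx.
  apply: (@leq_trans (\sum_(p : {set 'I_s} | j \notin p)
     ((0 < #|C p| : nat) + (#|C p| - 1)))).
    by apply: leq_sum => p _; case: #|C p| => // k; rewrite subn1.
  rewrite big_split /= leq_add2r.
  apply: leq_trans (proj2 (up a)).
  rewrite -big_mkcondr /= sum1_card.
  have : [set p : {set 'I_s} | (j \notin p) && (0 < #|C p|)] \subset
     [set p :\ j | p in [set p | 0 < w a p]].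
    apply/fintype.subsetP => p; rewrite inE => /andP[jp /card_gt0P[t]]; rewrite inE => /eqP pt.
    apply/finset.imsetP; exists (pat a t) => //; rewrite inE; apply/card_gt0P.
    by exists t; rewrite inE.
  move/fintype.subset_leq_card/leq_trans; move/(_ _ (leq_imset_card _ _)).
  by rewrite cardsE.
(* Exchanging [x] with the entry of [a] at place [j] is an involution of the pairs [(a, x)], so
   resampling preserves the average of [E]. *)
have total j : \sum_a \sum_x E (upd a j x) j = #|X| * \sum_a E a j.
  pose h (q : {ffun 'I_s -> X} * X) := (upd q.1 j q.2, q.1 j).
  have hK : involutive h.
    case=> a x; congr pair; last by rewrite ffunE eqxx.
    by apply/ffunP => i; rewrite !ffunE; case: eqP => // ->.
  have := reindex_inj (inv_inj hK) (op := addn) (x := 0)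
    (P := predT) (F := fun q => E q.1 j) => /= rE.
  rewrite pair_big /= -rE -(pair_big predT predT (fun a _ => E a j)) /= big_distrr /=.
  by apply: eq_bigr => a _; rewrite sum_nat_const.
have N0 : 0 < #|{ffun 'I_s -> X}| by rewrite card_ffun expn_gt0 X0.
set P := s.+1 ^ d; have main : s * ((#|T| - P) * D) <= 2 * #|X| * (d * #|T|).
  rewrite -(leq_pmul2l N0).
  apply: (@leq_trans (\sum_j \sum_a 2 * \sum_x E (upd a j x) j)).
    rewrite mulnCA -{1}(card_ord s) -sum_nat_const; apply: leq_sum => j _.
    by rewrite -sum_nat_const; apply: leq_sum => a _; exact: low.
  under eq_bigr => j _ do rewrite -big_distrr /= total.
  rewrite -!big_distrr /= mulnA [X in _ <= X]mulnCA leq_mul2l exchange_big /=.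
  apply/orP; right; rewrite -sum_nat_const.
  by apply: leq_sum => a _; exact: (proj1 (up a)).
have sD0 : 0 < s * D by apply: leq_trans sD; rewrite !muln_gt0 d0 X0.
have : s * D * (2 * (#|T| - P)) <= s * D * #|T|.
  apply: leq_trans (_ : 4 * d * #|X| * #|T| <= _); last by rewrite leq_mul2r sD orbT.
  move: main; move: (#|T| - P) => y; nia.
rewrite leq_pmul2l //; lia.
Qed.

Local Open Scope ring_scope.

(** * Inner products, orthonormal systems and sign patterns of hyperplanes *)

Definition dot (R : pzSemiRingType) n (u v : 'rV[R]_n) : R := \sum_i u ord0 i * v ord0 i.

Section Dot.
Variables (R : rcfType) (n : nat).
Implicit Types u v h : 'rV[R]_n.

Lemma dotC u v : dot u v = dot v u.
Proof. by apply: eq_bigr => i _; rewrite mulrC. Qed.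

Lemma dotDr u v h : dot u (v + h) = dot u v + dot u h.
Proof. by rewrite -big_split; apply: eq_bigr => i _; rewrite !mxE mulrDr. Qed.

Lemma dotZr u a v : dot u (a *: v) = a * dot u v.
Proof. by rewrite mulr_sumr; apply: eq_bigr => i _; rewrite !mxE mulrCA. Qed.

Lemma dotNr u v : dot u (- v) = - dot u v.
Proof. by rewrite -scaleN1r dotZr mulN1r. Qed.

Lemma dotBr u v h : dot u (v - h) = dot u v - dot u h.
Proof. by rewrite dotDr dotNr. Qed.

Lemma dotBl u v h : dot (v - h) u = dot v u - dot h u.
Proof. by rewrite dotC dotBr dotC [dot u h]dotC. Qed.

Lemma dotZl u a v : dot (a *: v) u = a * dot v u.
Proof. by rewrite dotC dotZr dotC. Qed.

Lemma dot0r u : dot u 0 = 0.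
Proof. by rewrite -(scale0r u) dotZr mul0r. Qed.

Lemma dot_sumr (I : Type) (r : seq I) (F : I -> 'rV[R]_n) u :
  dot u (\sum_(i <- r) F i) = \sum_(i <- r) dot u (F i).
Proof. exact: (big_morph (dot u) (dotDr u) (dot0r u)). Qed.

Lemma dot_delta u i : dot (delta_mx ord0 i) u = u ord0 i.
Proof.
rewrite /dot (bigD1 i) //= big1 ?addr0 => [|j ij]; first by rewrite mxE !eqxx mul1r.
by rewrite mxE (negbTE ij) andbF mul0r.
Qed.

Lemma dot_ge0 u : 0 <= dot u u.
Proof. by apply: sumr_ge0 => i _; rewrite -expr2 sqr_ge0. Qed.

Lemma dot_gt0 u : u != 0 -> 0 < dot u u.
Proof.
move=> u0; rewrite lt_neqAle dot_ge0 andbT eq_sym; apply: contraNneq u0.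
move=> /eqP; rewrite psumr_eq0 => [/allP h|i _]; last by rewrite -expr2 sqr_ge0.
apply/eqP/rowP => i; rewrite mxE; apply/eqP.
by have := h i (mem_index_enum _); rewrite mulf_eq0 orbb.
Qed.

Lemma dot_le1 u v : dot u u <= 1 -> dot v v <= 1 -> `|dot u v| <= 1.
Proof.
move=> hu hv; have h1 := dot_ge0 (u - v); have h2 := dot_ge0 (u - (- v)).
move: h1 h2; rewrite !dotBl !dotBr ![dot (- v) _]dotC !dotNr [dot v u]dotC [dot (- v) v]dotC dotNr.
by move=> h1 h2; rewrite ler_norml; apply/andP; split; lra.
Qed.

Lemma exists_orthogonal_unit (L : seq 'rV[R]_n) : (size L < n)%N ->
  exists h, dot h h = 1 /\ forall v, v \in L -> dot v h = 0.
Proof.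
move=> sL; pose M : 'M[R]_(n, size L) := \matrix_(i, j) (tnth (in_tuple L) j) ord0 i.
have : kermx M != 0.
  rewrite kermx_eq0; apply/negP => /eqP rM.
  by move: (rank_leq_col M); rewrite rM leqNgt sL.
case/rowV0Pn => h /sub_kermxP hM h0.
pose c := Num.sqrt (dot h h).
have c0 : 0 < c by rewrite sqrtr_gt0 dot_gt0.
exists (c^-1 *: h); split.
  rewrite dotZr dotZl mulrA -{1}(@sqr_sqrtr _ (dot h h)) ?dot_ge0 // -/c.
  by field; rewrite gt_eqF.
move=> v vL; rewrite dotZr; apply/eqP; rewrite mulf_eq0; apply/orP; right.
have [j ->] : exists j, v = tnth (in_tuple L) j.
  by have /tnthP[j ->] : v \in in_tuple L by []; exists j.
move/rowP/(_ j): hM; rewrite !mxE => <-; apply/eqP; apply: eq_bigr => i _.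
by rewrite mxE mulrC.
Qed.

(** Each chosen vector joins the list to which the later ones are orthogonal. The last clause is
    Bessel's inequality, obtained from the induction hypothesis at [v - dot v h *: h]. *)
Lemma exists_orthonormal (L : seq 'rV[R]_n) k : (size L + k <= n)%N ->
  exists H : seq 'rV[R]_n, [/\ size H = k,
    (forall h, h \in H -> dot h h = 1 /\ forall v, v \in L -> dot v h = 0) &
    forall v, \sum_(h <- H) dot v h ^+ 2 <= dot v v].
Proof.
elim: k L => [|k IH] L sL.
  by exists [::]; split => // v; rewrite big_nil dot_ge0.
have [|h [h1 hL]] := @exists_orthogonal_unit L; first by apply: leq_trans sL; rewrite addnS ltnS leq_addr.
have [|H [sH H1 HB]] := IH (h :: L); first by rewrite /= addSn -addnS.
exists (h :: H); split => [|g|v]; first by rewrite /= sH.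
  rewrite inE => /orP[/eqP -> //|/H1[g1 gL]]; split => // v vL.
  by apply: gL; rewrite inE vL orbT.
rewrite big_cons; have := HB (v - dot v h *: h).
rewrite (eq_big_seq (fun g => dot v g ^+ 2)) => [|g /H1[_ /(_ h (mem_head _ _)) hg]].
  rewrite dotBl !dotBr !dotZl !dotZr h1 [dot h v]dotC expr2; lra.
by rewrite dotBl dotZl hg mulr0 subr0.
Qed.

End Dot.

(* [d.+1] hyperplanes do not cut the affine chart [u_c = 1] into [2 ^ d.+1]
   cells: a linear relation [sum_i w_i l_i = kap e_c] excludes one pattern. *)
Lemma sign_pattern_avoided (R : rcfType) (d : nat) (c : 'I_d.+1)
    (l : 'I_d.+1 -> 'rV[R]_d.+1) :
  exists b : 'I_d.+1 -> bool, forall u : 'rV[R]_d.+1, u ord0 c = 1 ->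
    exists i, (0 < dot u (l i)) != b i.
Proof.
have [w [kap [wE wk]]] : exists (w : 'I_d.+1 -> R) (kap : R),
    (forall u : 'rV[R]_d.+1, u ord0 c = 1 -> \sum_i w i * dot u (l i) = kap) /\
    (0 < kap \/ kap = 0 /\ exists i, 0 < w i).
  pose L : 'M[R]_d.+1 := \matrix_(i, j) l i ord0 j.
  (* The [d.+2] rows of [M] are linearly dependent in dimension [d.+1]. The sign of the relation is
     then chosen to make [kap] nonnegative and, if [kap = 0], some [w i] positive. *)
  pose M := col_mx L (delta_mx (@ord0 0) c).
  have : kermx M != 0.
    rewrite kermx_eq0; apply/negP => /eqP rM; move: (rank_leq_col M).
    by rewrite rM addn1 ltnn.
  case/rowV0Pn => w /sub_kermxP wM w0.
  rewrite -(hsubmxK w) mul_row_col in wM.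
  pose w1 := lsubmx w; pose w2 := rsubmx w.
  have wE (u : 'rV[R]_d.+1) : u ord0 c = 1 -> \sum_i w1 ord0 i * dot u (l i) = - w2 ord0 ord0.
    move=> uc; under eq_bigr => i _ do rewrite /dot mulr_sumr.
    rewrite exchange_big /=.
    have h j : \sum_i w1 ord0 i * (u ord0 j * l i ord0 j) = - (w2 ord0 ord0 * (j == c)%:R * u ord0 j).
      have e1 : (w1 *m L) ord0 j = \sum_i w1 ord0 i * l i ord0 j.
        by rewrite mxE; apply: eq_bigr => i _; rewrite [L _ _]mxE.
      have e2 : (w2 *m delta_mx ord0 c) ord0 j = w2 ord0 ord0 * (j == c)%:R.
        by rewrite mxE big_ord1 [delta_mx _ _ _ _]mxE eqxx.
      have e0 : (w1 *m L) ord0 j + (w2 *m delta_mx ord0 c) ord0 j = 0.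
        by move/rowP/(_ j): wM; rewrite [in LHS]mxE [RHS]mxE.
      rewrite -e2 -mulNr; move/eqP: e0; rewrite addr_eq0 => /eqP <-; rewrite e1 mulr_suml.
      by apply: eq_bigr => i _; rewrite mulrA mulrAC.
    under eq_bigr => j _ do rewrite h.
    rewrite (bigD1 c) //= eqxx mulr1 uc mulr1 big1 ?addr0 // => j /negbTE ->.
    by rewrite mulr0 mul0r oppr0.
  have [k0|k0|k0] := ltgtP 0 (- w2 ord0 ord0).
  - by exists (fun i => w1 ord0 i), (- w2 ord0 ord0); split; [exact: wE|left].
  - exists (fun i => - w1 ord0 i), (w2 ord0 ord0); split; last by left; rewrite -oppr_lt0.
    move=> u uc; under eq_bigr do rewrite mulNr.
    by rewrite sumrN (wE u uc) opprK.
  - have w2_0 : w2 = 0 by apply/rowP => j; rewrite [RHS]mxE (ord1 j); apply/eqP; rewrite -oppr_eq0 -k0.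
    have [i wi] : exists i, w1 ord0 i != 0.
      apply/existsP; rewrite -[X in is_true X]negbK negb_exists; apply/negP => /forallP w10.
      move/negP: w0; apply; rewrite -(hsubmxK w) -/w1 -/w2 w2_0.
      suff -> : w1 = 0 by rewrite row_mx0.
      by apply/rowP => j; rewrite [RHS]mxE; apply/eqP; have := w10 j; rewrite negbK.
    case: (ltrP 0 (w1 ord0 i)) => wi0.
      exists (fun i => w1 ord0 i), 0; split; last by right; split => //; exists i.
      by move=> u /wE ->; rewrite -k0.
    exists (fun i => - w1 ord0 i), 0; split; last first.
      by right; split => //; exists i; rewrite oppr_gt0 lt_neqAle wi.
    move=> u uc; under eq_bigr do rewrite mulNr.
    by rewrite sumrN (wE u uc) -k0 oppr0.
(* The avoided pattern would make all terms of the relation nonpositive if [kap > 0], and all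
   nonnegative with a positive one if [kap = 0]. *)
case: wk => [kap0|[kap0 [i0 wi0]]].
  exists (fun i => w i < 0) => u uc.
  apply/existsP; rewrite -[X in is_true X]negbK negb_exists; apply/negP => /forallP h.
  have := wE u uc; apply/eqP; rewrite lt_eqF //.
  apply: le_lt_trans kap0; apply: sumr_le0 => i _.
  have := h i; rewrite negbK => /eqP; case: (ltrP (w i) 0) => wi; case: (ltrP 0 (dot u (l i))) => hi //= _.
    by rewrite nmulr_rle0 // ltW.
  by rewrite mulr_ge0_le0.
exists (fun i => 0 < w i) => u uc.
apply/existsP; rewrite -[X in is_true X]negbK negb_exists; apply/negP => /forallP h.
have := wE u uc; apply/eqP; rewrite gt_eqF // kap0.
have hi i : 0 <= w i * dot u (l i).
  have := h i; rewrite negbK => /eqP; case: (ltrP 0 (w i)) => wi; case: (ltrP 0 (dot u (l i))) => hi //= _.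
    by rewrite mulr_ge0 ?ltW.
  by rewrite mulr_le0.
rewrite (bigD1 i0) //= ltr_wpDr ?sumr_ge0 //.
by have := h i0; rewrite negbK wi0 => /eqP hh; rewrite mulr_gt0.
Qed.

(** * Nets in an affine chart for the number of separating hyperplanes *)

Lemma count_below (R : realFieldType) (m : nat) (x : R) : 0 <= x <= m%:R ->
  x <= (#|[pred t : 'I_m | t%:R < x]|)%:R <= x + 1.
Proof.
move=> /andP[x0 xm].
pose S k := (\sum_(t < k) ((t%:R < x)%R : nat))%N.
suff h k : Num.min x k%:R <= (S k)%:R <= x + 1.
  have := h m; rewrite (min_idPl xm) => /andP[h1 h2].
  rewrite (_ : #|_| = S m) ?h1 //.
  by rewrite -sum1_card big_mkcond; apply: eq_bigr => t _; rewrite inE; case: ifP.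
elim: k => [|k /andP[IH1 IH2]].
  by rewrite /S big_ord0 ge_min lexx orbT; lra.
have SS : S k.+1 = (S k + (k%:R < x)%R)%N by rewrite /S big_ord_recr.
rewrite SS natrD; case: (ltrP k%:R x) => kx.
  have e : S k = k.
    rewrite -[RHS]card_ord -sum1_card; apply: eq_bigr => t _.
    by rewrite (le_lt_trans _ kx) // ler_nat ltnW.
  by rewrite e natr1 ge_min lexx orbT /= -natr1; lra.
move: IH1 IH2; rewrite (min_idPl kx) => IH1 IH2.
by rewrite addr0 ge_min IH1.
Qed.

(** A [D]-separated family that cannot be enlarged is a net. The bound [B] on the sizes makes greedy
    enlargement stop, whence the induction on [B - size V]. *)
Lemma maximal_separated (T : eqType) (P : T -> Prop) (s : T -> T -> nat) (D B : nat) :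
  (forall u v, s u v = s v u) -> (forall u, s u u < D)%N ->
  (forall V : seq T, uniq V -> (forall v, v \in V -> P v) ->
     {in V &, forall u v, u != v -> D <= s u v}%N -> (size V <= B)%N) ->
  exists V : seq T, [/\ forall v, v \in V -> P v, (size V <= B)%N &
    forall u, P u -> exists2 v, v \in V & (s u v < D)%N].
Proof.
move=> sC s0 sB.
suff grow k V : uniq V -> (forall v, v \in V -> P v) ->
     {in V &, forall u v, u != v -> D <= s u v}%N -> (B - size V = k)%N ->
  exists V : seq T, [/\ forall v, v \in V -> P v, (size V <= B)%N &
    forall u, P u -> exists2 v, v \in V & (s u v < D)%N].
  by apply: (grow _ [::] _ _ _ erefl).
elim: k V => [|k IH] V uV VP sV kV;
  have [h|/existsNP[u /not_implyP[Pu /forall2NP uV']]] :=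
    pselect (forall u, P u -> exists2 v, v \in V & (s u v < D)%N);
  try by (exists V; split => //; exact: sB).
all: have uD v : v \in V -> (D <= s u v)%N
  by move=> vV; rewrite leqNgt; apply/negP; case: (uV' v).
all: have uNV : u \notin V by apply/negP => /uD; rewrite leqNgt s0.
all: have uV1 : uniq (u :: V) by rewrite /= uNV.
all: have VP1 v : v \in u :: V -> P v by rewrite inE => /orP[/eqP -> //|/VP].
all: have sV1 : {in u :: V &, forall u v, u != v -> D <= s u v}%N
  by move=> v w; rewrite !inE => /orP[/eqP ->|vV] /orP[/eqP ->|wV];
    rewrite ?eqxx // => ?; [exact: uD|rewrite sC; exact: uD|exact: sV].
  by have := sB _ uV1 VP1 sV1; rewrite /=; lia.
by apply: (IH (u :: V)) => //=; lia.
Qed.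

Section Chart.
Variables (R : rcfType) (d m : nat) (y : 'I_m -> 'rV[R]_d.+1) (c : 'I_d.+1).
Hypothesis m0 : (0 < m)%N.

(** A unit vector divided by its largest coordinate lies in one of these charts. The normalisation
    lowers the VC dimension from [d.+1] to [d], which becomes the exponent in the size of the
    nets. *)
Definition chart (u : 'rV[R]_d.+1) := u ord0 c = 1 /\ forall l, `|u ord0 l| <= 1.

Definition ground := ('I_m + 'I_d.+1 * 'I_m)%type.

(* The points [inr (l, t)] stand for the hyperplanes [u_l = 2t/m - 1], which
   make [sep] dominate the coordinatewise distance, see [sep_coord]. *)
Definition ground_normal (z : ground) : 'rV[R]_d.+1 :=
  match z with
  | inl i => y i
  | inr (l, t) => delta_mx ord0 l - (2 * t%:R / m%:R - 1) *: delta_mx ord0 c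
  end.

Definition above (z : ground) (u : 'rV[R]_d.+1) : bool := 0 < dot u (ground_normal z).

Definition sep (u v : 'rV[R]_d.+1) : nat := #|[pred z | above z u != above z v]|.

Lemma sepC u v : sep u v = sep v u.
Proof. by apply: eq_card => z; rewrite !inE eq_sym. Qed.

Lemma sepxx u : sep u u = 0%N.
Proof. by apply: eq_card0 => z; rewrite !inE eqxx. Qed.

Lemma sep_points u v :
  (#|[pred i | (0 < dot u (y i))%R != (0 < dot v (y i))%R]| <= sep u v)%N.
Proof.
rewrite -(fintype.card_image (@inl_inj 'I_m ('I_d.+1 * 'I_m)%type)).
by apply/fintype.subset_leq_card/fintype.subsetP => _ /fintype.imageP[i hi ->].
Qed.

(** The affine map [h] sends [[-1, 1]] to [[0, m]]. The number of auxiliary hyperplanes below a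
    point is [h] of its coordinate up to one, and two such numbers differ by at most [sep u v]. *)
Lemma sep_coord u v l : chart u -> chart v ->
  `|u ord0 l - v ord0 l| * m%:R <= 2 * (sep u v).+1%:R.
Proof.
move=> [uc u1] [vc v1].
have mR : 0 < m%:R :> R by rewrite ltr0n.
pose h (x : R) := (x + 1) * m%:R / 2.
have hE (w : 'rV[R]_d.+1) t : w ord0 c = 1 -> above (inr (l, t)) w = (t%:R < h (w ord0 l)).
  move=> wc; rewrite /above /= dotBr dotZr ![dot w _]dotC !dot_delta wc mulr1 /h.
  apply/idP/idP => hh.
    have : 2 * t%:R / m%:R < w ord0 l + 1 by lra.
    by rewrite ltr_pdivrMr //; lra.
  have : 2 * t%:R / m%:R < w ord0 l + 1 by rewrite ltr_pdivrMr //; lra.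
  lra.
have hb (w : 'rV[R]_d.+1) : `|w ord0 l| <= 1 -> 0 <= h (w ord0 l) <= m%:R.
  by rewrite ler_norml => /andP[w1 w2]; rewrite /h; apply/andP; split; nra.
have cmp (w w' : 'rV[R]_d.+1) : w ord0 c = 1 -> w' ord0 c = 1 ->
   (#|[pred t : 'I_m | (t%:R < h (w ord0 l))%R]| <= #|[pred t : 'I_m | (t%:R < h (w' ord0 l))%R]| + sep w w')%N.
  move=> wc wc'.
  have inj : injective (fun t : 'I_m => inr (l, t) : ground) by move=> t t' [].
  have : (#|[pred t : 'I_m | above (inr (l, t)) w != above (inr (l, t)) w']| <= sep w w')%N.
    rewrite -(fintype.card_image inj).
    by apply/fintype.subset_leq_card/fintype.subsetP => _ /fintype.imageP[t ht ->].
  rewrite -(leq_add2l #|[pred t : 'I_m | (t%:R < h (w' ord0 l))%R]|); apply: leq_trans.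
  rewrite -cardUI; apply: leq_trans (leq_addr _ _); apply/fintype.subset_leq_card/fintype.subsetP => t.
  by rewrite !inE !hE // => ->; case: (_ < _).
have /andP[a1 a2] := count_below (hb _ (u1 l)).
have /andP[b1 b2] := count_below (hb _ (v1 l)).
have := cmp _ _ uc vc; have := cmp _ _ vc uc; rewrite (sepC v u) -!(ler_nat R) !natrD.
rewrite -natr1 -[m%:R]gtr0_norm // -normrM ler_norml => h1 h2.
by move: a1 a2 b1 b2; rewrite /h => a1 a2 b1 b2; apply/andP; split; lra.
Qed.

Lemma exists_net (s D : nat) : (0 < d)%N -> (0 < D)%N ->
  (4 * d * (d.+2 * m) <= s * D)%N ->
  exists V : seq 'rV[R]_d.+1, [/\ forall v, v \in V -> chart v,
    (size V <= 2 * s.+1 ^ d)%N &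
    forall u, chart u -> exists2 v, v \in V & (sep u v < D)%N].
Proof.
move=> d0 D0 sD; apply: maximal_separated => [u v|u|V uV Vc Vsep].
- exact: sepC.
- by rewrite sepxx.
have cX : #|{: ground}| = (d.+2 * m)%N.
  by rewrite card_sum card_prod !card_ord -mulSn.
have := @haussler_packing 'I_(size V) ground
  (fun t z => above z (tnth (in_tuple V) t)) d D s d0.
rewrite card_ord cX muln_gt0 m0 => -> //.
- move=> g; have [b bP] := sign_pattern_avoided c (fun i => ground_normal (g i)).
  exists b => t; apply: bP.
  by have [] := Vc _ (mem_tnth t (in_tuple V)).
- move=> t t' tt'.
  have -> : #|finset (fun x : ground => above x (tnth (in_tuple V) t) != above x (tnth (in_tuple V) t'))|
    = sep (tnth (in_tuple V) t) (tnth (in_tuple V) t').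
    by rewrite cardsE.
  apply: Vsep; rewrite ?(mem_tnth _ (in_tuple V)) //.
  apply: contraNneq tt'; rewrite !(tnth_nth 0) /= => /eqP.
  by rewrite nth_uniq.
Qed.

(** Haussler's bound is [O((m / 4 ^ k) ^ d)]. The first hypothesis says that [4 ^ k1] is large
    enough for the net of level [k1] to have at most [m / K] points; each finer level costs a factor
    [4 ^ d]. The second absorbs the rounding of [q]. *)
Lemma exists_scaled_net (K k1 : nat) : (0 < d)%N ->
  (4 * K * 2 ^ d * (4 * d * d.+2) ^ d * m ^ d.-1 <= 4 ^ (k1 * d))%N ->
  (4 * K * 4 ^ d <= m)%N ->
  forall k, exists V : seq 'rV[R]_d.+1, [/\ forall v, v \in V -> chart v,
    ((k <= k1)%N -> (K * size V <= m * 4 ^ (d * (k1 - k)))%N) &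
    forall u, chart u -> exists2 v, v \in V & (sep u v < 4 ^ k)%N].
Proof.
move=> d0 hB hm k.
set a := (4 * d * d.+2)%N in hB.
pose q := ((a * m) %/ 4 ^ k)%N.
have P4 : (0 < 4 ^ k)%N by rewrite expn_gt0.
have [|V [Vc Vs Vn]] := @exists_net q.+1 (4 ^ k) d0 P4.
  by rewrite mulnA -/a; apply: ltnW; rewrite ltn_ceil.
exists V; split => // kk1.
have h1 : (q * 4 ^ k <= a * m)%N by exact: leq_trunc_div.
have h2 : (q ^ d * 4 ^ (k * d) <= a ^ d * (m * m ^ d.-1))%N.
  by rewrite expnM -expnMn -expnS prednK // -expnMn leq_exp2r.
have h3 : ((4 * K * 2 ^ d) * q ^ d <= m * 4 ^ (d * (k1 - k)))%N.
  have P4' : (0 < 4 ^ (k * d))%N by rewrite expn_gt0.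
  rewrite -(leq_pmul2r P4') -[X in (_ <= X)%N]mulnA -expnD.
  have -> : (d * (k1 - k) + k * d = k1 * d)%N by rewrite mulnC -mulnDl subnK.
  apply: leq_trans (leq_mul (leqnn m) hB).
  rewrite -mulnA; apply: leq_trans (leq_mul (leqnn _) h2) _.
  by apply: eq_leq; ring.
have h4 : (q.+2 ^ d <= 2 ^ d * (q ^ d + 2 ^ d))%N.
  rewrite mulnDr -!expnMn; case: (leqP q 2) => q2.
    by apply: leq_trans (leq_addl _ _); rewrite leq_exp2r //; lia.
  by apply: leq_trans (leq_addr _ _); rewrite leq_exp2r //; lia.
have h5 : (4 * K * 4 ^ d <= m * 4 ^ (d * (k1 - k)))%N.
  by apply: leq_trans hm _; rewrite leq_pmulr // expn_gt0.
have h6 : (4 ^ d = 2 ^ d * 2 ^ d)%N by rewrite -expnMn.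
apply: leq_trans (leq_mul (leqnn K) Vs) _.
apply: leq_trans (_ : K * (2 * (2 ^ d * (q ^ d + 2 ^ d))) <= _)%N.
  by rewrite !leq_mul2l h4 !orbT.
rewrite h6 in h5; move: h3 h5.
move: (2 ^ d)%N (q ^ d)%N (m * _)%N => e qd M; nia.
Qed.

End Chart.

Local Open Scope classical_set_scope.
Local Open Scope ring_scope.

(** * The partial colouring lemma, by minimising a sum of hyperbolic cosines *)

Section Phi.
Variable R : realType.
Implicit Types s t z : R.

Definition twocosh s := expR s + expR (- s).

Lemma twocoshD s t : twocosh (s + t) + twocosh (s - t) = twocosh s * twocosh t.
Proof. rewrite /twocosh !opprD opprK !expRD; ring. Qed.

Lemma twocosh0 : twocosh 0 = 2.
Proof. by rewrite /twocosh oppr0 expR0. Qed.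

Lemma twocosh_gt0 s : 0 < twocosh s.
Proof. by rewrite addr_gt0 ?expR_gt0. Qed.

Lemma twocosh_ge s : expR `|s| <= twocosh s.
Proof. by rewrite /twocosh; case: (ger0P s) => _; rewrite ?lerDl ?lerDr expR_ge0. Qed.

(** Adding [expR y <= (1 - y)^-1] at [z] and at [- z] gives the bound [2 / (1 - z ^+ 2)]. *)
Lemma twocosh_le z : `|z| <= 1 / 2 -> twocosh z - 2 <= 4 * z ^+ 2.
Proof.
have aux (y : R) : `|y| <= 1/2 -> expR y <= (1 - y)^-1.
  rewrite ler_norml => /andP[y1 y2].
  rewrite -[expR y]opprK -[expR y]invrK -expRN opprK lef_pV2 ?posrE; try lra.
  - by have := expR_ge1Dx (- y); lra.
  - by rewrite expR_gt0.
move=> hz; have h1 := aux z hz; have h2 := aux (- z); rewrite normrN in h2.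
have {}h2 := h2 hz; move: hz; rewrite ler_norml => /andP[z1 z2].
have z3 : z ^+ 2 <= 1 / 4 by rewrite expr2; nra.
have e : (1 - z)^-1 + (1 - - z)^-1 = 2 / (1 - z ^+ 2).
  by field; apply/and3P; split; rewrite gt_eqF //; lra.
rewrite lerBlDr; apply: le_trans (lerD h1 h2) _; rewrite e ler_pdivrMr; nra.
Qed.

End Phi.

Lemma continuous_dot (R : realType) n (u : 'rV[R]_n) : continuous (dot u).
Proof.
rewrite /dot; apply: continuous_big => [x|i _ v]; first exact: add_continuous.
by apply: continuousM; [exact: cst_continuous|exact: coord_continuous].
Qed.

Lemma continuous_dot2 (R : realType) n : continuous (fun v : 'rV[R]_n => dot v v).
Proof.
rewrite /dot; apply: continuous_big => [x|i _ v]; first exact: add_continuous.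
by apply: continuousM; exact: coord_continuous.
Qed.

(** Gives one step length below the slacks of all inactive constraints; the active ones have slack
    zero and are skipped. *)
Lemma exists_pos_lb (R : realFieldType) (s : seq R) :
  exists2 t : R, 0 < t <= 1 & forall x, x \in s -> 0 < x -> t <= x.
Proof.
elim: s => [|x s [t /andP[t0 t1] ht]]; first by exists 1; rewrite // ltr01 lexx.
case: (ltP 0 x) => x0.
  exists (Num.min t x); first by rewrite lt_min t0 x0 ge_min t1.
  by move=> y; rewrite inE ge_min => /orP[/eqP -> _|/ht h /h ->]; rewrite ?lexx ?orbT.
exists t; first by rewrite t0.
by move=> y; rewrite inE => /orP[/eqP ->|/ht //]; rewrite ltNge x0.
Qed.

Section PartialColoring.
Variables (R : realType) (N : nat) (E : seq 'rV[R]_N) (vs : seq ('rV[R]_N * R)).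
Hypothesis N0 : (0 < N)%N.
Hypothesis HE : (8 * size E <= N)%N.
Hypothesis Hv : forall p, p \in vs -> dot p.1 p.1 <= 1 /\ 0 < p.2.
Hypothesis Hs : 32 * \sum_(p <- vs) expR (- p.2) <= N%:R.

Let K := [set c : 'rV[R]_N | [/\ forall i, `|c ord0 i| <= 1,
   forall e, e \in E -> dot e c = 0 &
   forall p, p \in vs -> `|dot p.1 c| <= 8 * p.2]].

(** With this weight the cosine sum is at most [N] at the origin, by [Hs], while a tight constraint,
    whose cosine has argument [p.2] or [- p.2], contributes at least [16]. *)
Let a (p : 'rV[R]_N * R) := 16 * expR (- p.2).
Let F (c : 'rV[R]_N) := \sum_(p <- vs) a p * twocosh (dot p.1 c / 8) - dot c c.

Let compactK : compact K.
Proof.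
have box := @rV_compact R N (fun=> `[(-1 : R), 1]%classic) (fun _ => @segment_compact _ _ _).
apply: (subclosed_compact _ box).
  have -> : K = \bigcap_(i in [set: 'I_N]) ((fun c : 'rV[R]_N => `|c ord0 i|) @^-1` [set x | x <= 1])
   `&` (\bigcap_(e in [set` E]) (dot e @^-1` [set x | x = 0])
   `&` \bigcap_(p in [set` vs]) ((fun c : 'rV[R]_N => `|dot p.1 c|) @^-1` [set x | x <= 8 * p.2])).
    apply/seteqP; split => c /=.
      by move=> [h1 h2 h3]; split => [i _|]; [exact: h1|split => e /= he; [exact: h2|exact: h3]].
    move=> [h1 [h2 h3]]; split => [i|e he|p hp]; [exact: h1|exact: h2|exact: h3].
  apply: closedI; [|apply: closedI]; apply: closed_bigI => i _; apply: preimage_closed.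
  - move=> c _; apply: continuous_comp; [exact: coord_continuous|exact: norm_continuous].
  - exact: closed_le.
  - move=> c _; exact: continuous_dot.
  - exact: closed_eq.
  - move=> c _; apply: continuous_comp; [exact: continuous_dot|exact: norm_continuous].
  - exact: closed_le.
by move=> c [h1 _ _] i /=; rewrite in_itv /= -ler_norml.
Qed.

Let continuousF : continuous F.
Proof.
have G : continuous (fun c : 'rV[R]_N => \sum_(p <- vs) a p * twocosh (dot p.1 c / 8)).
  apply: continuous_big => [x|p _ v]; first exact: add_continuous.
  have hc : {for v, continuous (cst (a p) : 'rV[R]_N -> R)} by exact: cst_continuous.
  apply: (continuousM hc).
  have h : dot p.1 x / 8 @[x --> v] --> dot p.1 v / 8.
    by apply: continuousM; [exact: continuous_dot|exact: cst_continuous].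
  have h1 : expR (dot p.1 x / 8) @[x --> v] --> expR (dot p.1 v / 8).
    by apply: (cvg_comp _ (@expR R) h); exact: continuous_expR.
  have h2 : expR (- (dot p.1 x / 8)) @[x --> v] --> expR (- (dot p.1 v / 8)).
    by apply: (cvg_comp _ (@expR R) (cvgN h)); exact: continuous_expR.
  exact: (cvgD h1 h2).
by move=> v; exact: (cvgB (G v) (@continuous_dot2 R N v)).
Qed.

(* The potential bounds the number of active constraints by [N / 8], since each
   contributes at least [16]; the orthonormal system [H] of directions keeping
   the active constraints then has at least [N / 4] members, and averaging over
   it gives one along which the second difference of [F] is negative. *)
Lemma partial_coloring : exists c : 'rV[R]_N,
  [/\ (forall i, `|c ord0 i| <= 1),
      (forall e, e \in E -> dot e c = 0),
      (forall p, p \in vs -> `|dot p.1 c| <= 8 * p.2) &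
      (N <= 2 * #|[pred i | `|c ord0 i|%R == 1%R]|)%N].
Proof.
have K0 : K 0.
  split => [i|e _|p /Hv[_ /ltW p0]]; first by rewrite mxE normr0 ler01.
    by rewrite dot0r.
  by rewrite dot0r normr0 mulr_ge0.
have [c cK cmin] := compact_EVT_min (ex_intro _ _ K0) compactK
  (continuous_subspaceT continuousF).
rewrite inE in cK; have [c1 cE cv] := cK.
exists c; split => //; rewrite leqNgt; apply/negP => cB.
have a0 p : 0 < a p by rewrite mulr_gt0 ?expR_gt0.
pose S := \sum_(p <- vs) a p * twocosh (dot p.1 c / 8).
have SN : S <= 2 * N%:R.
  have : F c <= F 0 by apply: cmin; rewrite inE.
  rewrite /F dot0r subr0 -/S => h.
  have : \sum_(p <- vs) a p * twocosh (dot p.1 0 / 8) <= N%:R.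
    apply: le_trans Hs; rewrite mulr_sumr; apply: ler_sum => p _.
    by rewrite dot0r mul0r twocosh0 /a; lra.
  have : dot c c <= N%:R.
    rewrite -[N in N%:R]card_ord -sumr_const; apply: ler_sum => i _.
    by rewrite -expr2 -real_normK ?num_real // expr_le1.
  by move: h; lra.
pose tight := [seq p <- vs | `|dot p.1 c| == 8 * p.2].
have [k kE] : exists k, k = size tight by exists (size tight).
have tightN : (8 * k <= N)%N.
  have : 16 * k%:R <= S.
    rewrite kE /S.
    apply: le_trans (_ : \sum_(p <- tight) a p * twocosh (dot p.1 c / 8) <= _); last first.
      rewrite big_filter big_mkcond /= ; apply: ler_sum => p _.
      by case: ifP => // _; rewrite mulr_ge0 // ltW // twocosh_gt0.
    rewrite -sum1_size natr_sum mulr_sumr big_seq [X in _ <= X]big_seq.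
    apply: ler_sum => p; rewrite mem_filter => /andP[/eqP tp pvs].
    have := twocosh_ge (dot p.1 c / 8); rewrite normrM tp.
    rewrite [ `|8^-1| ]gtr0_norm // mulrAC divff // mul1r => h.
    rewrite mulr1 /a -mulrA -[X in X <= _]mulr1 ler_pM2l //.
    by apply: le_trans (ler_wpM2l (expR_ge0 _) h); rewrite -expRD addNr expR0.
  move=> h; move: (le_trans h SN); rewrite -!natrM ler_nat; lia.
pose B := [pred i | `|c ord0 i| == 1].
(* Directions orthogonal to [L] keep the equations, the tight bounds and the entries of modulus one.
   The three parts have at most [N/8], [N/8] and [N/2] members, which leaves dimension at least
   [N/4]. *)
pose L := E ++ [seq p.1 | p <- tight] ++ [seq delta_mx ord0 i | i <- enum B].
have sL : (8 * size L <= 6 * N)%N.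
  have [b bE] : exists b, b = #|B| by exists #|B|.
  have cB' : (2 * b < N)%N by rewrite bE.
  have -> : size L = (size E + (k + b))%N.
    by rewrite /L !size_cat !size_map -cardE kE bE.
  move: HE; move: (size E) => e; move: tightN cB'; lia.
have [|H [sH HL HB]] := @exists_orthonormal R N L (N - size L).
  by rewrite subnKC //; move: sL; move: (size L) => l; lia.
pose Q h := \sum_(p <- vs) a p * twocosh (dot p.1 c / 8) * dot p.1 h ^+ 2.
have QS : \sum_(h <- H) Q h <= S.
  rewrite exchange_big /= /S big_seq [X in _ <= X]big_seq; apply: ler_sum => p pvs.
  rewrite -mulr_sumr -[X in _ <= X]mulr1 ler_wpM2l //.
    by rewrite mulr_ge0 ?ltW // twocosh_gt0.
  by apply: le_trans (HB _) _; have [] := Hv pvs.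
(* Values of [Q] all at least [9] would sum to at least [9N/4], more than the bound [2N] on [S]. *)
have [h hH Qh] : exists2 h, h \in H & Q h < 9.
  apply/hasP; rewrite -[has _ _]negbK; apply/negP; rewrite -all_predC => /allP allQ.
  have : 9 * (size H)%:R <= \sum_(h <- H) Q h.
    rewrite -sum1_size natr_sum mulr_sumr big_seq [X in _ <= X]big_seq.
    by apply: ler_sum => h /allQ /=; rewrite mulr1 -leNgt.
  move=> h9; have := le_trans h9 (le_trans QS SN); rewrite sH.
  rewrite -!natrM ler_nat.
  by move: sL N0; move: (size L) => l; lia.
have [hh hL] := HL h hH.
have hvs p : p \in vs -> `|dot p.1 h| <= 1.
  by move=> /Hv[p1 _]; apply: dot_le1; rewrite ?hh.
have [t /andP[t0 t1] ht] := exists_pos_lb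
  ([seq 1 - `|c ord0 i| | i <- enum 'I_N] ++ [seq 8 * p.2 - `|dot p.1 c| | p <- vs]).
have inK s : `|s| = t -> K (c + s *: h).
  move=> st; split => [i|e eE|p pvs].
  - rewrite !mxE; case: (eqVneq `|c ord0 i| 1) => ci.
      suff -> : h ord0 i = 0 by rewrite mulr0 addr0 ci.
      rewrite -dot_delta; apply: hL; rewrite !mem_cat; apply/orP; right; apply/orP; right.
      by apply: map_f; rewrite mem_enum inE ci.
    have : t <= 1 - `|c ord0 i|.
      apply: ht; first by rewrite mem_cat (map_f (fun i => 1 - `|c ord0 i|)) // mem_enum.
      by rewrite subr_gt0 lt_neqAle ci c1.
    have : `|h ord0 i| <= 1.
      rewrite -dot_delta; apply: dot_le1; last by rewrite hh.
      by rewrite dot_delta mxE !eqxx.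
    have := ler_normD (c ord0 i) (s * h ord0 i); rewrite normrM st.
    nra.
  - by rewrite dotDr dotZr cE // hL ?mulr0 ?addr0 // mem_cat eE.
  - rewrite dotDr dotZr; case: (eqVneq `|dot p.1 c| (8 * p.2)) => pt.
      rewrite hL ?mulr0 ?addr0 ?pt // !mem_cat; apply/orP; right; apply/orP; left.
      by apply: map_f; rewrite mem_filter pt eqxx.
    have : t <= 8 * p.2 - `|dot p.1 c|.
      apply: ht; last by rewrite subr_gt0 lt_neqAle pt cv.
      by rewrite mem_cat (map_f (fun p => 8 * p.2 - `|dot p.1 c|)) ?orbT.
    have := ler_normD (dot p.1 c) (s * dot p.1 h); rewrite normrM st.
    have := hvs _ pvs; nra.
have Fp : F c <= F (c + t *: h) by apply: cmin; rewrite inE; apply: inK; rewrite gtr0_norm.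
have Fm : F c <= F (c + (- t) *: h) by apply: cmin; rewrite inE; apply: inK; rewrite normrN gtr0_norm.
(* The second difference of the cosines is bounded by [twocosh_le] with argument at most [t / 8],
   hence the factor [4 / 64]; that of [- dot c c] is [- 2 * t ^+ 2]. As [Q h < 9], the total is
   negative, against minimality of [c]. *)
have : F (c + t *: h) + F (c + (- t) *: h) - 2 * F c <= t ^+ 2 * (Q h / 16 - 2).
  have -> : F (c + t *: h) + F (c + (- t) *: h) - 2 * F c =
     \sum_(p <- vs) a p * twocosh (dot p.1 c / 8) * (twocosh (t * dot p.1 h / 8) - 2)
      - 2 * t ^+ 2.
    have -> : \sum_(p <- vs) a p * twocosh (dot p.1 c / 8) * (twocosh (t * dot p.1 h / 8) - 2)
      = \sum_(p <- vs) a p * twocosh (dot p.1 (c + t *: h) / 8)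
      + \sum_(p <- vs) a p * twocosh (dot p.1 (c + (- t) *: h) / 8) - 2 * S.
      rewrite /S mulr_sumr -big_split -sumrB /=; apply: eq_bigr => p _.
      have -> : dot p.1 (c + t *: h) / 8 = dot p.1 c / 8 + t * dot p.1 h / 8.
        by rewrite dotDr dotZr mulrDl.
      have -> : dot p.1 (c + (- t) *: h) / 8 = dot p.1 c / 8 - t * dot p.1 h / 8.
        by rewrite dotDr dotZr mulNr mulrBl.
      have := twocoshD (dot p.1 c / 8) (t * dot p.1 h / 8).
      move: (twocosh _) (twocosh (_ - _)) (twocosh (dot _ _ / _)) (twocosh _) => x y z w h1.
      by rewrite -mulrDr h1; ring.
    rewrite /F -/S ![dot (_ + _) _]dotC !dotDr !dotZr.
    rewrite ![dot (_ + _) _]dotC !dotDr !dotZr hh [dot h c]dotC; ring.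
  rewrite mulrBr lerB //; last by rewrite mulrC.
  rewrite /Q mulr_suml mulr_sumr big_seq [X in _ <= X]big_seq; apply: ler_sum => p pvs.
  have ap : 0 <= a p * twocosh (dot p.1 c / 8) by rewrite mulr_ge0 ?ltW // twocosh_gt0.
  have := @twocosh_le R (t * dot p.1 h / 8).
  rewrite !normrM (gtr0_norm t0) [ `|8^-1| ]gtr0_norm // => tw.
  have {}tw := ler_wpM2l ap (tw _); apply: le_trans (tw _) _.
    by have := hvs _ pvs; nra.
  by rewrite le_eqVlt; apply/orP; left; apply/eqP; field.
have t2 : 0 < t ^+ 2 by rewrite exprn_gt0.
by move: Fp Fm Qh t2; nra.
Qed.

End PartialColoring.

(** * Chaining: a colouring of the atoms that is small on the whole sphere *)

Lemma dot_le_coord (R : realDomainType) n (u v : 'rV[R]_n) (a : R) :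
  (forall l, `|u ord0 l| <= a) -> (forall l, `|v ord0 l| <= 1) ->
  `|dot u v| <= n%:R * a.
Proof.
move=> hu hv; apply: le_trans (ler_norm_sum _ _ _) _.
apply: le_trans (_ : \sum_(i < n) a <= _); last first.
  by rewrite sumr_const card_ord mulr_natl.
apply: ler_sum => i _; rewrite normrM -[X in _ <= X]mulr1.
by apply: ler_pM.
Qed.

Lemma unit_coord_le1 (R : rcfType) n (v : 'rV[R]_n) l : dot v v = 1 -> `|v ord0 l| <= 1.
Proof.
move=> v1; rewrite -dot_delta; apply: dot_le1; last by rewrite v1.
by rewrite dot_delta mxE !eqxx.
Qed.

Lemma sum_geometric4 (R : realFieldType) n : \sum_(k < n) (4^-1 : R) ^+ (n - k) <= 1.
Proof.
elim: n => [|n IH]; first by rewrite big_ord0 ler01.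
rewrite big_ord_recr /= subSnn.
under eq_bigr => k _ do rewrite subSn ?exprS 1?ltnW //.
by rewrite -mulr_sumr; lra.
Qed.

(** Since [n - k <= 2 ^ (n - k)], each term is at most [2 ^ n * 4 ^ k], and the remaining sum is
    geometric. *)
Lemma sum_weighted8 (R : realFieldType) n :
  \sum_(k < n) ((n - k)%:R * 8 ^+ k : R) <= 8 ^+ n.
Proof.
have h k : (k <= n)%N -> ((n - k)%:R * 8 ^+ k : R) <= 2 ^+ n * 4 ^+ k.
  move=> kn; rewrite (_ : 8 = 2 * 4 :> R); last by lra.
  rewrite exprMn mulrA ler_wpM2r ?exprn_ge0 // -[in X in _ <= X](subnK kn) exprD.
  by rewrite ler_wpM2r ?exprn_ge0 // -natrX ler_nat ltnW // ltn_expl.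
apply: le_trans (_ : \sum_(k < n) 2 ^+ n * 4 ^+ k <= _).
  by apply: ler_sum => k _; apply: h; exact: ltnW.
rewrite -mulr_sumr (_ : 8 = 2 * 4 :> R); last by lra.
rewrite exprMn ler_wpM2l ?exprn_ge0 //.
elim: n {h} => [|n IH]; first by rewrite big_ord0 expr0 ler01.
rewrite big_ord_recr /= exprS; have : 0 <= (4 : R) ^+ n by rewrite exprn_ge0.
lra.
Qed.

Lemma expRN_le_quarter (R : realType) n : expR (- (2 * n)%:R : R) <= 4^-1 ^+ n.
Proof.
rewrite -mulrN1 expRM_natl exprM.
rewrite lerXn2r ?nnegrE ?exprn_ge0 ?expR_ge0 ?invr_ge0 //.
have e2 : (2 : R) <= expR 1 by have := expR_ge1Dx (1 : R); lra.
rewrite expRN exprVn lef_pV2 ?posrE ?exprn_gt0 ?expR_gt0 // expr2; nra.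
Qed.

Lemma sumr_const_seq (V : nmodType) (I : Type) (s : seq I) (x : V) :
  \sum_(i <- s) x = x *+ size s.
Proof. by rewrite big_const_seq count_predT iter_addr_0. Qed.

(** With nets of [m / K] points at level [k1], this [K] keeps both budgets of the partial colouring:
    about [(d+1)^2 m / K] equations, and a sum of exponentials of at most [(d+1)(d+2) m / K]. *)
Definition net_const (d : nat) : nat := 32 * d.+2 ^ 2.
Definition scale_const (d : nat) : nat := 4 * net_const d * 2 ^ d * (4 * d * d.+2) ^ d.
Definition min_points (d : nat) : nat := 4 * net_const d * 4 ^ d.

(* The vectors on which an increment of [G] is tested: [x] bounds its value at
   the net point [x], and the scaled basis vectors bound its variation around
   [x]. *)
HB.lock Definition with_axes (R : pzRingType) n (r : R) (x : 'rV[R]_n) : seq 'rV[R]_n :=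
  x :: [seq r *: delta_mx ord0 l | l <- enum 'I_n].

Lemma size_with_axes (R : pzRingType) n (r : R) (x : 'rV[R]_n) : size (with_axes r x) = n.+1.
Proof. by rewrite with_axes.unlock /= size_map size_enum_ord. Qed.

Section KeyColoring.
Variables (R : realType) (d m k1 : nat) (y : 'I_m -> 'rV[R]_d.+1) (w : 'I_m -> R).
Let K := net_const d.
Hypothesis d0 : (0 < d)%N.
Hypothesis hB : (scale_const d * m ^ d.-1 <= 4 ^ (k1 * d))%N.
Hypothesis hm : (min_points d <= m)%N.
Hypothesis y1 : forall i, dot (y i) (y i) = 1.
Hypothesis w1 : forall i, 0 <= w i <= 1.

Let m0 : (0 < m)%N.
Proof.
by apply: leq_trans hm; rewrite /min_points /net_const !(muln_gt0, expn_gt0).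
Qed.

Let mR : 0 < m%:R :> R.
Proof. by rewrite ltr0n. Qed.

Let yc i l : `|y i ord0 l| <= 1.
Proof. exact: unit_coord_le1. Qed.

(** The value at zero is [-1], so that the sign depends only on the test [0 < dot x (y i)] counted
    by [sep]. *)
Let sg (x : 'rV[R]_d.+1) i : R := if 0 < dot x (y i) then 1 else -1.
(** Let [x] and [x'] in a chart have fewer than [4 ^ k.+1] separating hyperplanes. Then [rho k]
    bounds the products of [x - x'] with the atoms, and [kap k] bounds the norm of [av x x' p],
    which has at most [4 ^ k.+1] nonzero entries, each at most [2 * rho k]. *)
Let rho k : R := d.+1%:R * (8 * 4 ^+ k / m%:R).
Let kap k : R := 4 * 2 ^+ k * rho k.
Let av (x x' p : 'rV[R]_d.+1) : 'rV[R]_m :=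
  \row_i (w i * (sg x i - sg x' i) * dot p (y i)).

Let rho_gt0 k : 0 < rho k.
Proof. by rewrite /rho !(mulr_gt0, exprn_gt0, invr_gt0, ltr0n). Qed.

Let kap_gt0 k : 0 < kap k.
Proof. by rewrite /kap; apply: mulr_gt0; [rewrite mulr_gt0 ?exprn_gt0|exact: rho_gt0]. Qed.

Let av_norm c (x x' p : 'rV[R]_d.+1) k : (sep y c x x' < 4 ^ k.+1)%N ->
  (forall i, (0 < dot x (y i)) != (0 < dot x' (y i)) -> `|dot p (y i)| <= rho k) ->
  dot (av x x' p) (av x x' p) <= kap k ^+ 2.
Proof.
move=> hsep hp.
apply: le_trans (_ : \sum_i (if (0 < dot x (y i)) != (0 < dot x' (y i)) then 4 * rho k ^+ 2 else 0) <= _).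
  apply: ler_sum => i _; rewrite mxE /sg; have := hp i.
  have [h0 h1] := andP (w1 i).
  have aux (e : R) : `|e| = 2 -> `|dot p (y i)| <= rho k ->
     w i * e * dot p (y i) * (w i * e * dot p (y i)) <= 4 * rho k ^+ 2.
    move=> e2 hr; rewrite -expr2 -real_normK ?num_real // !normrM e2 (ger0_norm h0).
    have -> : 4 * rho k ^+ 2 = (2 * rho k) ^+ 2 by ring.
    rewrite lerXn2r ?nnegrE //; first by rewrite !mulr_ge0.
      by rewrite mulr_ge0 // ltW.
    rewrite [w i * 2]mulrC -mulrA ler_pM2l //.
    by apply: le_trans hr; rewrite -[X in _ <= X]mul1r ler_wpM2r.
  case: (ltrP 0 (dot x (y i))) => hx; case: (ltrP 0 (dot x' (y i))) => hx' //=.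
  - by rewrite subrr mulr0 mul0r mul0r.
  - by move=> /(_ isT); apply: aux; rewrite opprK gtr0_norm.
  - by move=> /(_ isT); apply: aux; rewrite -opprD normrN gtr0_norm.
  - by rewrite subrr mulr0 mul0r mul0r.
rewrite -big_mkcond /= sumr_const.
apply: le_trans (_ : (4 * rho k ^+ 2) *+ 4 ^ k.+1 <= _).
  apply: ler_wpMn2l; first by rewrite mulr_ge0 ?sqr_ge0.
  apply: leq_trans (ltnW hsep); exact: sep_points.
have e4 : (4 : R) ^+ k = 2 ^+ k * 2 ^+ k by rewrite -exprMn; congr (_ ^+ k); ring.
rewrite -mulr_natr natrX [4 ^+ k.+1]exprS e4 /kap; move: (2 ^+ k) (rho k) => e r.
by rewrite le_eqVlt; apply/orP; left; apply/eqP; ring.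
Qed.

Lemma key_coloring : exists c : 'rV[R]_m,
  [/\ (forall i, `|c ord0 i| <= 1),
      \sum_i c ord0 i * w i = 0,
      (forall x : 'rV[R]_d.+1, dot x x = 1 ->
        `|\sum_i c ord0 i * w i * `|dot x (y i)| | <= 2 ^+ 10 * d.+1%:R ^+ 2 * 8 ^+ k1 / m%:R) &
      (m <= 2 * #|[pred i | `|c ord0 i|%R == 1%R]|)%N].
Proof.
have /choice[V0 HV0] (ck : 'I_d.+1 * nat) := @exists_scaled_net R d m y ck.1 m0 K k1 d0 hB hm ck.2.
pose V c k := V0 (c, k).
have Vc c k v : v \in V c k -> chart c v by have [h _ _] := HV0 (c, k); exact: h.
have Vs c k : (k <= k1)%N -> (K * size (V c k) <= m * 4 ^ (d * (k1 - k)))%N.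
  by have [_ h _] := HV0 (c, k); exact: h.
have /choice[pi0 Hpi0] (cku : 'I_d.+1 * nat * 'rV[R]_d.+1) :
    exists v, chart cku.1.1 cku.2 -> v \in V cku.1.1 cku.1.2 /\ (sep y cku.1.1 cku.2 v < 4 ^ cku.1.2)%N.
  have [h|h] := pselect (chart cku.1.1 cku.2); last by exists 0.
  have [_ _ hn] := HV0 cku.1; have [v vV vs] := hn _ h; exists v => _.
  by split => //; rewrite /V -surjective_pairing.
pose pi c k u := pi0 (c, k, u).
have piV c k u : chart c u -> pi c k u \in V c k by move=> /(Hpi0 (c, k, u))[].
have pis c k u : chart c u -> (sep y c u (pi c k u) < 4 ^ k)%N by move=> /(Hpi0 (c, k, u))[].
(* Then [expR (- lam i)] is at most [4 ^ (- (d+1) i)], which outweighs the [4 ^ (d i)] growth of the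
   nets and leaves a geometric series. *)
pose lam i : R := (2 * (d.+1 * i))%:R.
pose P (x : 'rV[R]_d.+1) k := with_axes (rho k) x.
pose vs := flatten [seq flatten [seq flatten [seq
   [seq ((kap k)^-1 *: av x (pi c k.+1 x) p, lam (k1 - k)%N) | p <- P x k]
   | x <- V c k] | k <- index_iota 0 k1] | c <- enum 'I_d.+1].
(* The first equation preserves the total mass; the others make [G] vanish on the coarsest nets. *)
pose E := (\row_i w i) :: flatten [seq flatten [seq
   [seq (\row_i (w i * sg x i * y i ord0 l) : 'rV[R]_m) | l <- enum 'I_d.+1]
   | x <- V c k1] | c <- enum 'I_d.+1].
have sE : (8 * size E <= m)%N.
  have hE : size E = (\sum_(c < d.+1) size (V c k1) * d.+1).+1.
    rewrite /= size_flatten /shape -map_comp sumnE big_map big_enum /=; congr S.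
    apply: eq_bigr => c _ /=; rewrite size_flatten /shape -map_comp sumnE big_map.
    by under eq_bigr do rewrite /= size_map -cardE card_ord; rewrite big_const_seq count_predT iter_addn_0 mulnC.
  rewrite hE; set T := (\sum_(c < _) _)%N.
  have : (K * T <= d.+1 * (m * d.+1))%N.
    rewrite big_distrr /= -[X in (_ <= X * _)%N]card_ord -sum_nat_const.
    apply: leq_sum => c _; rewrite mulnA leq_mul2r.
    by have := Vs c k1 (leqnn _); rewrite subnn muln0 expn0 muln1 => ->.
  have : (4 * K <= m)%N by apply: leq_trans hm; rewrite /min_points leq_pmulr // expn_gt0.
  rewrite /K /net_const; clear; move: T => T; nia.
have hv p : p \in vs -> dot p.1 p.1 <= 1 /\ 0 < p.2.
  move=> /flatten_mapP[c _ /flatten_mapP[k]]; rewrite mem_index_iota => /andP[_ kk1].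
  move=> /flatten_mapP[x xV /mapP[p' p'P ->]] /=; split; last first.
    by rewrite ltr0n !muln_gt0 subn_gt0 kk1.
  have xc := Vc _ _ _ xV; have hs := pis c k.+1 x xc.
  have xc' := Vc _ _ _ (piV c k.+1 x xc).
  rewrite dotZl dotZr mulrA -invfM -expr2 mulrC ler_pdivrMr ?exprn_gt0 // mul1r.
  apply: (av_norm hs) => i hi.
  move: p'P; rewrite /P with_axes.unlock inE => /orP[/eqP ->|/mapP[l _ ->]]; last first.
    rewrite dotZl dot_delta normrM gtr0_norm // -[X in _ <= X]mulr1.
    by rewrite ler_pM2l.
  (* The hyperplane of [y i] separates the two points, so the values at [y i] have opposite signs
     and each is at most their difference. *)
  apply: le_trans (_ : `|dot (x - pi c k.+1 x) (y i)| <= _).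
    rewrite dotBl; move: hi; case: (ltrP 0 (dot x (y i))) => h1;
      case: (ltrP 0 (dot (pi c k.+1 x) (y i))) => h2 //= _.
      by rewrite !gtr0_norm //; lra.
    by rewrite !ler0_norm //; lra.
  apply: dot_le_coord => // l; rewrite !mxE ler_pdivlMr //.
  apply: le_trans (sep_coord y m0 l xc xc') _.
  rewrite (_ : 8 * 4 ^+ k = 2 * (4 ^ k.+1)%:R); last by rewrite natrX exprS; ring.
  by rewrite ler_pM2l // ler_nat.
have hs : 32 * \sum_(p <- vs) expR (- p.2) <= m%:R.
  have KR : 0 < K%:R :> R by rewrite ltr0n /K /net_const muln_gt0 expn_gt0.
  have hsum : \sum_(p <- vs) expR (- p.2) <= d.+1%:R * (d.+2%:R * (m%:R / K%:R)).
    rewrite big_flatten /= big_map big_enum /=.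
    apply: le_trans (_ : \sum_(c < d.+1) d.+2%:R * (m%:R / K%:R) <= _); last first.
      by rewrite sumr_const card_ord -[X in X <= _]mulr_natl.
    apply: ler_sum => c _; rewrite big_flatten /= big_map big_mkord.
    apply: le_trans (_ : \sum_(k < k1) d.+2%:R * (m%:R / K%:R) * 4^-1 ^+ (k1 - k) <= _); last first.
      rewrite -mulr_sumr; apply: ler_piMr; last exact: sum_geometric4.
      by apply: mulr_ge0 => //; apply: divr_ge0.
    apply: ler_sum => k _; rewrite big_flatten /= big_map.
    under eq_bigr => x _ do rewrite big_map /= sumr_const_seq size_with_axes.
    rewrite sumr_const_seq.
    set i := (k1 - k)%N; set e := expR _.
    have he : e <= 4^-1 ^+ (d.+1 * i) by exact: expRN_le_quarter.
    have hV : (size (V c k))%:R <= m%:R / K%:R * 4 ^+ (d * i) :> R.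
      rewrite mulrAC ler_pdivlMr // -natrX -!natrM ler_nat mulnC.
      exact: Vs (ltnW (ltn_ord k)).
    have e4 : (4 : R) ^+ (d * i) * 4^-1 ^+ (d.+1 * i) = 4^-1 ^+ i.
      by rewrite mulSn exprD mulrCA -exprMn mulfV ?expr1n ?mulr1.
    have -> : e *+ d.+2 *+ size (V c k) = d.+2%:R * ((size (V c k))%:R * e).
      by rewrite -mulrnA -[LHS]mulr_natl natrM mulrA.
    rewrite -[X in _ <= X]mulrA ler_pM2l ?ltr0n // -e4 mulrA.
    by apply: ler_pM; rewrite ?expR_ge0.
  apply: le_trans (ler_wpM2l _ hsum) _ => //.
  have mK : m%:R / K%:R * K%:R = m%:R :> R by rewrite divfK // gt_eqF.
  have KE : K%:R = 32 * d.+2%:R ^+ 2 :> R by rewrite /K /net_const natrM natrX.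
  have aux (q a b : R) : 0 <= q -> 0 <= a -> a <= b -> 32 * (a * (b * q)) <= q * (32 * b ^+ 2).
    move=> q0 a0 ab; rewrite (_ : q * _ = 32 * (b * (b * q))); last by ring.
    by rewrite ler_pM2l // ler_wpM2r // mulr_ge0 //; lra.
  rewrite -[X in _ <= X]mK [X in _ <= _ * X]KE.
  by apply: aux; [rewrite divr_ge0|exact: ler0n|rewrite ler_nat].
have [c [c1 cE cv cB]] := partial_coloring m0 sE hv hs.
exists c; split => //.
  have := cE _ (mem_head _ _); rewrite /dot => h; rewrite -[RHS]h.
  by apply: eq_bigr => i _; rewrite mxE mulrC.
pose G x : 'rV[R]_d.+1 := \sum_i (c ord0 i * w i * sg x i) *: y i.
have dotG p x : dot p (G x) = \sum_i c ord0 i * w i * sg x i * dot p (y i).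
  by rewrite dot_sumr; apply: eq_bigr => i _; rewrite dotZr.
have G0 ch x : x \in V ch k1 -> G x = 0.
  move=> xV; apply/rowP => l; rewrite mxE -dot_delta dotG.
  have /cE : (\row_i (w i * sg x i * y i ord0 l) : 'rV[R]_m) \in E.
    rewrite inE; apply/orP; right; apply/flatten_mapP; exists ch; first by rewrite mem_enum.
    by apply/flatten_mapP; exists x => //; apply: map_f; rewrite mem_enum.
  move=> h; rewrite -[RHS]h; apply: eq_bigr => i _; rewrite mxE dot_delta; ring.
have Gd ch k x p : (k < k1)%N -> x \in V ch k -> p \in P x k ->
   `|dot p (G x - G (pi ch k.+1 x))| <= 8 * (lam (k1 - k)%N * kap k).
  move=> kk1 xV pP.
  have /cv : ((kap k)^-1 *: av x (pi ch k.+1 x) p, lam (k1 - k)%N) \in vs.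
    apply/flatten_mapP; exists ch; first by rewrite mem_enum.
    apply/flatten_mapP; exists k; first by rewrite mem_index_iota.
    by apply/flatten_mapP; exists x => //; exact: (map_f (fun p => (_ *: av x _ p, _))).
  rewrite /= dotZl normrM gtr0_norm ?invr_gt0 // mulrC ler_pdivrMr // -mulrA.
  congr (`|_| <= _); rewrite dotBr !dotG -sumrB; apply: eq_bigr => i _.
  by rewrite mxE; ring.
(* The tests on the axes bound every coordinate of the increment, so the bound at [x] extends to [u]
   near [x] with a doubled constant. *)
have Gd2 ch k x (u : 'rV[R]_d.+1) : (k < k1)%N -> x \in V ch k ->
   (forall l, `|u ord0 l - x ord0 l| <= 4 * 4 ^+ k / m%:R) ->
   `|dot u (G x - G (pi ch k.+1 x))| <= 16 * (lam (k1 - k)%N * kap k).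
  move=> kk1 xV hu; set D := G x - _; set b := lam _ * _.
  have hx : `|dot x D| <= 8 * b.
    by apply: Gd => //; rewrite /P with_axes.unlock mem_head.
  have hD l : rho k * `|D ord0 l| <= 8 * b.
    have := @Gd ch k x (rho k *: delta_mx ord0 l) kk1 xV.
    rewrite dotZl dot_delta normrM gtr0_norm //; apply.
    rewrite /P with_axes.unlock inE; apply/orP; right.
    by apply: (map_f (fun l => _ *: delta_mx ord0 l)); rewrite mem_enum.
  have -> : dot u D = dot x D + dot (u - x) D by rewrite dotBl addrC subrK.
  apply: le_trans (ler_normD _ _) _.
  suff : `|dot (u - x) D| <= 8 * b by move: hx; lra.
  apply: le_trans (ler_norm_sum _ _ _) _.
  have dR : 0 < d.+1%:R :> R by rewrite ltr0n.
  rewrite -(ler_pM2l dR) mulr_sumr.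
  apply: le_trans (_ : \sum_(l < d.+1) 8 * b <= _); last first.
    by rewrite sumr_const card_ord -[X in X <= _]mulr_natl.
  apply: ler_sum => l _; apply: le_trans (hD l).
  rewrite normrM mulrA ler_wpM2r // /rho ler_pM2l //.
  rewrite !mxE; apply: le_trans (hu l) _.
  by rewrite ler_pM2r ?invr_gt0 // ler_pM2r ?exprn_gt0 //; lra.
pose F u := \sum_i c ord0 i * w i * `|dot u (y i)|.
have Hu ch u : chart ch u -> `|F u| <= 2 ^+ 10 * d.+1%:R ^+ 2 * 8 ^+ k1 / m%:R.
  move=> uc; pose xs k := iteri k (fun j v => pi ch j.+1 v) (pi ch 0%N u).
  have xsS k : xs k.+1 = pi ch k.+1 (xs k) by [].
  have xsV k : xs k \in V ch k.
    by elim: k => [|k IH]; [exact: piV|rewrite xsS; apply: piV; exact: Vc IH].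
  have xsd k l : `|u ord0 l - xs k ord0 l| <= 4 * 4 ^+ k / m%:R.
    elim: k => [|k IH].
      rewrite ler_pdivlMr //; apply: le_trans (sep_coord y m0 l uc (Vc _ _ _ (xsV 0%N))) _.
      have := pis ch 0%N u uc; rewrite expn0 ltnS leqn0 => /eqP ->.
      by rewrite expr0; lra.
    rewrite -[u ord0 l](subrK (xs k ord0 l)) -addrA; apply: le_trans (ler_normD _ _) _.
    have h1 : `|xs k ord0 l - xs k.+1 ord0 l| <= 8 * 4 ^+ k / m%:R.
      rewrite ler_pdivlMr //.
      apply: le_trans (sep_coord y m0 l (Vc _ _ _ (xsV k)) (Vc _ _ _ (xsV k.+1))) _.
      rewrite (_ : 8 * 4 ^+ k = 2 * (4 ^ k.+1)%:R); last by rewrite natrX exprS; ring.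
      by rewrite ler_pM2l // ler_nat; apply: pis; exact: Vc (xsV k).
    apply: le_trans (lerD IH h1) _; rewrite -mulrDl ler_pM2r ?invr_gt0 // exprS.
    have : 0 <= (4 : R) ^+ k by rewrite exprn_ge0.
    lra.
  (* At level 0 fewer than [4 ^ 0 = 1] hyperplanes separate [u] from its net point: both have the
     same signs, and the identity is exact. *)
  have FG : F u = dot u (G (xs 0%N)).
    rewrite dotG; apply: eq_bigr => i _; rewrite -[RHS]mulrA; congr (_ * _).
    have : sep y ch u (xs 0%N) = 0%N.
      by have := pis ch 0%N u uc; rewrite expn0 ltnS leqn0 => /eqP.
    move=> s0; have := sep_points y ch u (xs 0%N); rewrite s0 leqn0 => /eqP /card0_eq /(_ i).
    rewrite !inE => /negbT; rewrite negbK => /eqP si.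
    rewrite /sg -si.
    case: ltrP => hi; first by rewrite mul1r gtr0_norm.
    by rewrite mulN1r ler0_norm.
  have -> : F u = \sum_(k < k1) dot u (G (xs k) - G (xs k.+1)).
    rewrite FG -dot_sumr; congr (dot u _).
    rewrite -(big_mkord predT (fun k => G (xs k) - G (xs k.+1))).
    have := @telescope_sumr _ 0%N k1 (fun k => - G (xs k)) (leq0n _).
    rewrite (G0 _ _ (xsV k1)) oppr0 sub0r opprK => <-.
    by apply: eq_bigr => k _; rewrite opprK addrC.
  apply: le_trans (ler_norm_sum _ _ _) _.
  apply: le_trans (_ : \sum_(k < k1) 2 ^+ 10 * d.+1%:R ^+ 2 / m%:R * ((k1 - k)%:R * 8 ^+ k) <= _); last first.
    rewrite -mulr_sumr [X in _ <= X]mulrAC; apply: ler_wpM2l; last exact: sum_weighted8.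
    by apply: divr_ge0 => //; apply: mulr_ge0; exact: exprn_ge0.
  apply: ler_sum => k _; rewrite xsS.
  apply: le_trans (@Gd2 ch k (xs k) u (ltn_ord k) (xsV k) (xsd k)) _.
  rewrite /lam /kap /rho !natrM (_ : (8 : R) ^+ k = 2 ^+ k * 4 ^+ k); last first.
    by rewrite -exprMn; congr (_ ^+ _); ring.
  by rewrite le_eqVlt; apply/orP; left; apply/eqP; field; rewrite gt_eqF.
move=> x x1.
(* [F] is homogeneous for positive scaling and even, so it suffices to treat [x] divided by its
   largest coordinate, whose modulus is at most one. *)
have [ch hch] : exists ch, forall l, `|x ord0 l| <= `|x ord0 ch|.
  exists [arg max_(i > ord0) `|x ord0 i|]%O.
  by case: Order.TotalTheory.arg_maxP => // i _ hi l; exact: hi.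
have xch : x ord0 ch != 0.
  apply/negP => /eqP x0.
  have : dot x x = 0.
    apply: big1 => l _; have := hch l; rewrite x0 normr0 normr_le0 => /eqP ->.
    exact: mul0r.
  by rewrite x1 => /eqP; rewrite oner_eq0.
have uc : chart ch ((x ord0 ch)^-1 *: x).
  split=> [|l]; rewrite mxE; first by rewrite mulVf.
  by rewrite normrM normfV mulrC ler_pdivrMr ?normr_gt0 // mul1r.
apply: le_trans (Hu _ _ uc).
have -> : \sum_i c ord0 i * w i * `|dot x (y i)| = `|x ord0 ch| * F ((x ord0 ch)^-1 *: x).
  rewrite mulr_sumr; apply: eq_bigr => i _; rewrite dotZl normrM normfV.
  by field; rewrite normr_eq0.
rewrite normrM normr_id ler_piMl //; exact: unit_coord_le1.
Qed.

End KeyColoring.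

(** * One reduction step for finitely many weighted atoms *)

Definition potential (R : realType) n (mu : seq (R * 'rV[R]_n)) (x : 'rV[R]_n) : R :=
  \sum_(p <- mu) p.1 * `|dot x p.2|.

Definition sphere_weights (R : realType) n (mu : seq (R * 'rV[R]_n)) :=
  (forall p, p \in mu -> 0 <= p.1 /\ dot p.2 p.2 = 1) /\ \sum_(p <- mu) p.1 = 1.

(** All bounds are invariant under [c -> - c], and one of the two signs makes up half of the entries
    of modulus one. *)
Lemma signed_coloring (R : realType) (d m k1 : nat) (y : 'I_m -> 'rV[R]_d.+1) (w : 'I_m -> R) :
  (0 < d)%N -> (scale_const d * m ^ d.-1 <= 4 ^ (k1 * d))%N -> (min_points d <= m)%N ->
  (forall i, dot (y i) (y i) = 1) -> (forall i, 0 <= w i <= 1) ->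
  exists c : 'rV[R]_m,
  [/\ (forall i, `|c ord0 i| <= 1),
      \sum_i c ord0 i * w i = 0,
      (forall x : 'rV[R]_d.+1, dot x x = 1 ->
        `|\sum_i c ord0 i * w i * `|dot x (y i)| | <= 2 ^+ 10 * d.+1%:R ^+ 2 * 8 ^+ k1 / m%:R) &
      (m <= 4 * #|[pred i | c ord0 i == (-1)%R]|)%N].
Proof.
move=> d0 hB hm y1 w1; have [c [c1 c2 c3 c4]] := key_coloring d0 hB hm y1 w1.
have : (m <= 4 * #|[pred i | c ord0 i == (-1)%R]| \/ m <= 4 * #|[pred i | c ord0 i == 1%R]|)%N.
  have : (#|[pred i | `|c ord0 i|%R == 1%R]| <=
     #|[pred i | c ord0 i == (-1)%R]| + #|[pred i | c ord0 i == 1%R]|)%N.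
    rewrite -cardUI; apply: leq_trans (leq_addr _ _); apply/fintype.subset_leq_card/fintype.subsetP => i.
    by rewrite !inE eqr_norml ler01 andbT orbC.
  move: c4; move: #|[pred i | `|c ord0 i| == 1]| #|[pred i | c ord0 i == (-1)%R]| #|[pred i | c ord0 i == 1]|.
  lia.
case=> hc; first by exists c.
exists (- c); split => [i||x x1|].
- by rewrite mxE normrN.
- by under eq_bigr do rewrite mxE mulNr; rewrite sumrN c2 oppr0.
- by under eq_bigr do rewrite mxE !mulNr; rewrite sumrN normrN c3.
- apply: leq_trans hc _; rewrite leq_mul2l /=; apply/fintype.subset_leq_card/fintype.subsetP => i.
  by rewrite !inE mxE eqr_opp.
Qed.

Section Halving.
Variables (R : realType) (d : nat).
Hypothesis d0 : (0 < d)%N.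
Implicit Types mu : seq (R * 'rV[R]_d.+1).

Lemma halving_scale mu k1 (N := size mu) :
  sphere_weights mu -> (2 * min_points d <= N)%N ->
  (scale_const d * N ^ d.-1 <= 4 ^ (k1 * d))%N ->
  exists mu', [/\ sphere_weights mu', (8 * size mu' <= 7 * N)%N &
   forall x, dot x x = 1 -> `|potential mu x - potential mu' x|
      <= 2 ^+ 12 * d.+1%:R ^+ 2 * 8 ^+ k1 / N%:R ^+ 2].
Proof.
move=> [muP mu1] hN hk.
have N0 : (0 < N)%N.
  by apply: leq_trans hN; rewrite /min_points /net_const !(muln_gt0, expn_gt0).
have NR : 0 < N%:R :> R by rewrite ltr0n.
(* As the total mass is one, at most [N/2] atoms are heavier than [2/N]. *)
pose is_light (p : R * 'rV[R]_d.+1) := p.1 <= 2 / N%:R.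
pose light := [seq p <- mu | is_light p]; pose heavy := [seq p <- mu | predC is_light p].
pose m := size light; pose h := size heavy.
have mh : (m + h = N)%N by rewrite /m /h !size_filter count_predC.
have sumE (F : R * 'rV[R]_d.+1 -> R) :
    \sum_(p <- mu) F p = \sum_(p <- heavy) F p + \sum_(i < m) F (tnth (in_tuple light) i).
  rewrite -(perm_big _ (permEl (perm_filterC is_light mu))) big_cat addrC.
  by congr (_ + _); rewrite big_tnth.
have h2 : (2 * h <= N)%N.
  have : \sum_(p <- heavy) 2 / N%:R <= 1 :> R.
    rewrite -[X in _ <= X]mu1 sumE; apply: le_trans (_ : \sum_(p <- heavy) p.1 <= _).
      rewrite big_seq [X in _ <= X]big_seq; apply: ler_sum => p.
      rewrite mem_filter => /andP[+ _]; rewrite /= /is_light -ltNge; exact: ltW.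
    rewrite lerDl; apply: sumr_ge0 => i _.
    have := mem_tnth i (in_tuple light); rewrite mem_filter => /andP[_ /muP[]] //.
  rewrite sumr_const_seq -[X in X <= _]mulr_natl -/h mulrA ler_pdivrMr // mul1r -natrM ler_nat.
  by rewrite mulnC.
have hm : (N <= 2 * m)%N by rewrite -(leq_add2r (2 * h)) -mulnDr mh [X in (_ <= X)%N]mul2n -addnn leq_add2l.
have mm : (min_points d <= m)%N by rewrite -(leq_pmul2l (isT : 0 < 2)%N) (leq_trans hN).
have mN : (m <= N)%N by rewrite -mh leq_addr.
have m0 : (0 < m)%N by move: (leq_trans N0 hm); rewrite muln_gt0.
pose y i := (tnth (in_tuple light) i).2.
pose a i := (tnth (in_tuple light) i).1.
have lightP i : [/\ 0 <= a i, a i <= 2 / N%:R & dot (y i) (y i) = 1].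
  have := mem_tnth i (in_tuple light); rewrite mem_filter => /andP[hl /muP[? ?]].
  by split.
have hk' : (scale_const d * m ^ d.-1 <= 4 ^ (k1 * d))%N.
  apply: leq_trans hk; rewrite leq_mul2l; apply/orP; right.
  by case: (d.-1) => // e; rewrite leq_exp2r.
(* The factor [N / 2] brings the light weights into [[0, 1]]; dividing by it afterwards gains a
   further [1 / N] in the error. *)
have [||c [c1 c2 c3 c4]] := @signed_coloring R d m k1 y (fun i => N%:R / 2 * a i) d0 hk' mm.
- by move=> i; have [] := lightP i.
- move=> i; have [a0 a2 _] := lightP i; apply/andP; split.
    by rewrite mulr_ge0 // divr_ge0.
  apply: le_trans (ler_wpM2l _ a2) _; first by rewrite divr_ge0.
  by rewrite mulrA divfK // divff // gt_eqF.
have scale (g : 'I_m -> R) : \sum_i c ord0 i * (N%:R / 2 * a i) * g i =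
    N%:R / 2 * \sum_i c ord0 i * a i * g i.
  by rewrite mulr_sumr; apply: eq_bigr => i _; ring.
(* Atoms with [c_i = -1] get weight zero and are dropped: at least [m/4], hence [N/8], of them. *)
pose keep := [seq i <- enum 'I_m | c ord0 i != -1].
pose mu' := heavy ++ [seq ((1 + c ord0 i) * a i, y i) | i <- keep].
have sumE' (g : 'rV[R]_d.+1 -> R) : \sum_(p <- mu') p.1 * g p.2 =
   \sum_(p <- mu) p.1 * g p.2 + \sum_i c ord0 i * a i * g (y i).
  rewrite big_cat /= sumE -addrA; congr (_ + _).
  rewrite big_map /keep big_filter big_enum_cond /=.
  rewrite -big_split big_mkcond /=; apply: eq_bigr => i _; rewrite /= -/(a i) -/(y i).
  by case: eqP => [->|_] /=; ring.
exists mu'; split.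
- split=> [p|].
    rewrite mem_cat => /orP[|/mapP[i _ -> /=]]; first by rewrite mem_filter => /andP[_ /muP].
    have [a0 _ y1] := lightP i; split => //; rewrite mulr_ge0 //.
    by have := c1 i; rewrite ler_norml => /andP[? _]; lra.
  have := sumE' (fun=> 1); under eq_bigr do rewrite mulr1.
  move=> ->; under eq_bigr do rewrite mulr1; rewrite mu1.
  have := scale (fun=> 1); under eq_bigr do rewrite mulr1.
  rewrite c2 => /esym/eqP; rewrite mulf_eq0 => /orP[|/eqP ->]; last by rewrite addr0.
  by rewrite gt_eqF // divr_gt0.
- have hk2 : (size keep + #|[pred i | c ord0 i == (-1)%R]| = m)%N.
    rewrite -[RHS]card_ord -(cardC [pred i | c ord0 i == (-1)%R]) addnC; congr (_ + _)%N.
    rewrite -sum1_size /keep big_filter big_enum_cond /= sum1_card.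
    by apply: eq_card => i; rewrite !inE.
  have arith (k q a' b' n' : nat) : (k + q = a' -> a' + b' = n' -> a' <= 4 * q ->
    n' <= 2 * a' -> 8 * (b' + k) <= 7 * n')%N by clear; lia.
  by rewrite size_cat size_map -/h; exact: arith hk2 mh c4 hm.
- move=> x x1; rewrite /potential (sumE' (fun z => `|dot x z|)).
  rewrite opprD addrA subrr sub0r normrN.
  have := c3 x x1; rewrite (scale (fun i => `|dot x (y i)|)) normrM.
  rewrite gtr0_norm ?divr_gt0 // => hc.
  have mR : 0 < m%:R :> R by rewrite ltr0n.
  set S := \sum_i _ in hc *; set Q := 2 ^+ 10 * _ * _ in hc.
  have Q0 : 0 <= Q by rewrite !mulr_ge0 ?exprn_ge0.
  have hS : `|S| <= 2 / N%:R * (Q / m%:R).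
    by rewrite -ler_pdivrMl ?divr_gt0 // invf_div.
  apply: le_trans hS _; rewrite ler_pdivlMr ?exprn_gt0 //.
  have -> : 2 ^+ 12 * d.+1%:R ^+ 2 * 8 ^+ k1 = 4 * Q by rewrite /Q; ring.
  have -> : 2 / N%:R * (Q / m%:R) * N%:R ^+ 2 = 2 * (Q * (N%:R / m%:R)).
    by field; apply/andP; split; rewrite gt_eqF.
  rewrite (_ : 4 * Q = 2 * (Q * 2)); last by ring.
  by rewrite ler_pM2l // ler_wpM2l // ler_pdivrMr // -natrM ler_nat.
Qed.

(** For the least admissible [k1], minimality gives the upper bound up to one factor [4 ^ d]. *)
Lemma exists_scale N : (0 < N)%N ->
  exists2 k1, (scale_const d * N ^ d.-1 <= 4 ^ (k1 * d))%N &
    (4 ^ (k1 * d) <= 4 ^ d * (scale_const d * N ^ d.-1))%N.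
Proof.
move=> N0; set T := (scale_const d * N ^ d.-1)%N.
have T0 : (0 < T)%N.
  by rewrite /T /scale_const /net_const !(muln_gt0, expn_gt0) N0 d0.
have ex : exists k1, (T <= 4 ^ (k1 * d))%N.
  exists T; apply: leq_trans (_ : 4 ^ T <= _)%N; first by apply: ltnW; exact: ltn_expl.
  by rewrite leq_exp2l // leq_pmulr.
case: (ex_minnP ex) => k1 hk hmin; exists k1 => //.
case: k1 hk hmin => [|k] hk hmin; first by rewrite mul0n expn0 muln_gt0 expn_gt0.
rewrite mulSn expnD leq_mul2l expn_eq0 /=.
by case: (leqP (4 ^ (k * d)) T) => // /ltnW /hmin; rewrite ltnn.
Qed.

Definition rate : R := 1 / 2 + 3 / (2 * d%:R).

Lemma rate_ge : 1 / 2 <= rate.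
Proof. by rewrite /rate lerDl divr_ge0 // mulr_ge0. Qed.

(** With [4 ^ k1] of order [N ^ (1 - 1/d)], the cost [8 ^ k1 / N ^ 2] has exponent
    [3/2 - 3/(2d) - 2], which is [- rate]. *)
Lemma halving : exists2 C : R, 0 <= C & forall mu, sphere_weights mu ->
  (2 * min_points d <= size mu)%N ->
  exists mu', [/\ sphere_weights mu', (8 * size mu' <= 7 * size mu)%N &
   forall x, dot x x = 1 -> `|potential mu x - potential mu' x|
      <= C * (size mu)%:R `^ (- rate)].
Proof.
pose A : R := ((4 ^ d * scale_const d) ^ 3)%:R.
have A1 : 1 <= A.
  rewrite ler1n expn_gt0; apply/orP; left.
  by rewrite /scale_const /net_const !(muln_gt0, expn_gt0) d0.
exists (2 ^+ 12 * d.+1%:R ^+ 2 * A).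
  by rewrite !mulr_ge0 ?exprn_ge0.
move=> mu muP hN; set N := size mu.
have N0 : (0 < N)%N.
  by apply: leq_trans hN; rewrite /min_points /net_const !(muln_gt0, expn_gt0).
have NR : 0 < N%:R :> R by rewrite ltr0n.
have [k1 hk hk'] := exists_scale N0.
have [mu' [mu'P smu' hmu']] := halving_scale muP hN hk.
exists mu'; split => // x /hmu' {}hmu'; apply: le_trans hmu' _.
rewrite -/N; have : 0 <= 2 ^+ 12 * d.+1%:R ^+ 2 :> R by rewrite mulr_ge0 ?exprn_ge0.
move: (2 ^+ 12 * _) => B B0; rewrite -mulrA -[X in _ <= X]mulrA ler_wpM2l //.
rewrite ler_pdivrMr ?exprn_gt0 // -mulrA -(powR_mulrn 2 (ler0n R N)).
rewrite -powRD; last by rewrite (gt_eqF NR) implybT.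
have A0 : 0 <= A := le_trans ler01 A1.
have D0 : (0 < 2 * d)%N by rewrite muln_gt0.
(* Raising to the power [2 * d] clears the fractional exponents. *)
rewrite -(@ler_pXn2r _ _ D0) ?nnegrE ?exprn_ge0 ?mulr_ge0 ?powR_ge0 //.
rewrite exprMn -(powR_mulrn _ (powR_ge0 _ _)) -powRrM.
have -> : (- rate + 2%:R) * (2 * d)%:R = (3 * d.-1)%:R :> R.
  rewrite /rate !natrM -[in RHS]subn1 natrB //.
  by field; rewrite pnatr_eq0 -lt0n.
rewrite powR_mulrn ?ler0n //.
apply: le_trans (_ : A * N%:R ^+ (3 * d.-1) <= _); last first.
  by rewrite ler_wpM2r ?exprn_ge0 // ler_eXnr.
rewrite -!natrX -natrM ler_nat -expnM.
have -> : (8 ^ (k1 * (2 * d)) = (4 ^ (k1 * d)) ^ 3)%N.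
  rewrite -!expnM (_ : 8 = 2 ^ 3)%N // (_ : 4 = 2 ^ 2)%N // -!expnM; congr (_ ^ _)%N.
  by ring.
have -> : (N ^ (3 * d.-1) = (N ^ d.-1) ^ 3)%N by rewrite -expnM mulnC.
by rewrite -expnMn leq_exp2r // -mulnA.
Qed.

End Halving.

(** * Iteration of the reduction step *)

Section Iteration.
Variables (R : realType) (d : nat).
Hypothesis d0 : (0 < d)%N.
Implicit Types mu : seq (R * 'rV[R]_d.+1).

Let T (n : nat) : R := n%:R `^ (- rate R d).

Let rate0 : 0 <= rate R d.
Proof. by apply: le_trans (rate_ge R d); rewrite divr_ge0. Qed.

Let T_gt0 n : (0 < n)%N -> 0 < T n.
Proof. by move=> n0; rewrite powR_gt0 // ltr0n. Qed.

Let T_anti a b : (0 < a)%N -> (a <= b)%N -> T b <= T a.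
Proof.
move=> a0 ab; rewrite /T !powRN lef_pV2 ?posrE ?powR_gt0 ?ltr0n //; last exact: leq_trans ab.
by apply: ge0_ler_powR; rewrite ?nnegrE ?ler0n // ler_nat.
Qed.

Let T_le1 n : (0 < n)%N -> T n <= 1.
Proof. by move=> n0; have := T_anti (isT : 0 < 1)%N n0; rewrite {2}/T powR1. Qed.

(** The exponent is at least [1/2], and [21/20] is below the square root of [8/7]. *)
Let T_gain a b : (0 < a)%N -> (8 * a <= 7 * b)%N -> 21 / 20 * T b <= T a.
Proof.
move=> a0 ab.
have b0 : (0 < b)%N by case: b ab => //; case: a a0.
have h : 21 / 20 <= (8 / 7 : R) `^ rate R d.
  apply: le_trans (_ : (8 / 7 : R) `^ (1 / 2) <= _); last first.
    by apply: ler_powR; [lra|exact: rate_ge].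
  rewrite div1r powR12_sqrt; last by lra.
  have -> : 21 / 20 = Num.sqrt ((21 / 20) ^+ 2) :> R by rewrite sqrtr_sqr ger0_norm //; lra.
  by rewrite ler_sqrt ?expr2; lra.
rewrite /T !powRN ler_pdivrMr ?powR_gt0 ?ltr0n // [X in _ <= X]mulrC ler_pdivlMr ?powR_gt0 ?ltr0n //.
apply: le_trans (ler_wpM2r (powR_ge0 _ _) h) _.
have h87 : (0 : R) <= 8 / 7 by lra.
rewrite -powRM ?ler0n //.
apply: ge0_ler_powR; rewrite ?nnegrE ?mulr_ge0 ?ler0n //.
by move: ab; rewrite -(ler_nat R) !natrM; lra.
Qed.

Lemma potential_bounds mu x : sphere_weights mu -> dot x x = 1 -> 0 <= potential mu x <= 1.
Proof.
move=> [muP mu1] x1; apply/andP; split.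
  rewrite /potential big_seq; apply: sumr_ge0 => p /muP[p0 _].
  by rewrite mulr_ge0.
rewrite -[X in _ <= X]mu1 /potential big_seq [X in _ <= X]big_seq.
apply: ler_sum => p /muP[p0 p1]; rewrite ler_piMr //.
by apply: dot_le1; rewrite ?x1 ?p1.
Qed.

Lemma sparsification : exists C : R, forall n mu, (0 < n)%N -> sphere_weights mu ->
  exists mu', [/\ sphere_weights mu', (size mu' <= n)%N &
   forall x, dot x x = 1 -> `|potential mu x - potential mu' x| <= C * n%:R `^ (- rate R d)].
Proof.
have [C C0 step] := halving R d0.
pose N0 := (2 * min_points d)%N; pose L := 20 * C.
have N0p : (0 < N0)%N by rewrite /N0 /min_points /net_const !(muln_gt0, expn_gt0).
(* Here [C + L] pays for the last step, and [(1 + L) / T N0] for a measure with fewer than [N0]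
   atoms, which is replaced by a single atom at cost at most one. *)
pose K := C + L + (1 + L) / T N0.
have L0 : 0 <= L by rewrite mulr_ge0.
have K0 : 0 <= (1 + L) / T N0 by rewrite divr_ge0 ?addr_ge0 ?powR_ge0.
exists K => n mu n0 muP.
case: (leqP (size mu) n) => [sn|sn].
  exists mu; split => // x _; rewrite subrr normr0 mulr_ge0 ?powR_ge0 //.
  by rewrite !addr_ge0.
(* The term [- L T(size mu)] makes the bound inductive: one step costs at most
   [L (T(size mu1) - T(size mu))] because [T] grows by a factor [21 / 20]. *)
suff {muP sn} strong k : forall mu, (size mu <= k)%N -> (n < size mu)%N -> sphere_weights mu ->
  exists mu', [/\ sphere_weights mu', (size mu' <= n)%N &
   forall x, dot x x = 1 -> `|potential mu x - potential mu' x| <= K * T n - L * T (size mu)].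
  have [mu' [h1 h2 h3]] := strong _ mu (leqnn _) sn muP.
  exists mu'; split => // x /h3 {}h3; apply: le_trans h3 _.
  by rewrite lerBlDr lerDl mulr_ge0 ?powR_ge0.
elim: k => [|k IH] {}mu sk sn muP; first by move: (leq_trans sn sk).
have Tn := T_gt0 n0.
have TN : T (size mu) <= T n by apply: T_anti => //; exact: ltnW.
case: (leqP N0 (size mu)) => hN.
  have [mu1 [mu1P s1 h1]] := step mu muP hN.
  have := mu1P.2; case: (posnP (size mu1)) => [/size0nil ->|s0 _].
    by rewrite big_nil => /eqP; rewrite eq_sym oner_eq0.
  case: (leqP (size mu1) n) => sn1.
    exists mu1; split => // x /h1 {}h1; apply: le_trans h1 _.
    rewrite -/(T _) lerBrDr -mulrDl; apply: le_trans (_ : (C + L) * T n <= _).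
      by rewrite ler_wpM2l // addr_ge0.
    by rewrite ler_wpM2r ?powR_ge0 // lerDl.
  have [|mu' [mu'P s' h']] := IH mu1 _ sn1 mu1P.
    by move: s1 sk sn s0; move: (size mu1) (size mu); lia.
  exists mu'; split => // x x1.
  rewrite -(subrK (potential mu1 x) (potential mu x)) -addrA.
  apply: le_trans (ler_normD _ _) _; apply: le_trans (lerD (h1 _ x1) (h' _ x1)) _.
  rewrite -/(T _); have := T_gain s0 s1; have := T_gt0 (ltn_trans n0 sn).
  rewrite /L; move: (T (size mu)) (T (size mu1)) => t t1 t0 tt.
  have : C * (21 / 20 * t) <= C * t1 by rewrite ler_wpM2l.
  lra.
have [p pmu] : exists p, p \in mu.
  have := muP.2; case: (mu) => [|p s _]; last by exists p; rewrite mem_head.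
  by rewrite big_nil => /eqP; rewrite eq_sym oner_eq0.
have P1 : sphere_weights [:: (1, p.2)].
  split; last by rewrite big_seq1.
  by move=> q; rewrite inE => /eqP -> /=; split => //; have [] := muP.1 _ pmu.
exists [:: (1, p.2)]; split => // x x1.
have /andP[a0 a1] := potential_bounds muP x1.
have /andP[b0 b1] := potential_bounds P1 x1.
apply: le_trans (_ : 1 <= _); first by rewrite ler_norml; apply/andP; split; lra.
have TN0 : T N0 <= T n by apply: T_anti => //; apply: ltnW; exact: ltn_trans hN.
have h : 1 + L <= (1 + L) / T N0 * T n.
  rewrite mulrAC ler_pdivlMr ?T_gt0 // ler_wpM2l // addr_ge0 //.
have := T_le1 (ltn_trans n0 sn) => t1.
have : L * T (size mu) <= L by rewrite ler_piMr.
have : 0 <= (C + L) * T n by rewrite mulr_ge0 ?addr_ge0 // ltW.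
rewrite /K mulrDl; lra.
Qed.

End Iteration.

(** * Passage between probability measures and finite weighted sums *)

Section Discretization.
Context d (T : measurableType d) (R : realType).

Lemma Rintegral_step_approx (P : probability T R) (f : T -> R) (A : nat -> set T)
    (p : nat -> T) (q : nat) (e : R) :
  measurable_fun setT f -> (forall y, 0 <= f y) -> 0 <= e ->
  (forall i, measurable (A i)) -> trivIset setT A ->
  P (~` (\big[setU/set0]_(i < q) A i)) = 0%E ->
  (forall i y, A i y -> `|f y - f (p i)| <= e) ->
  `|Rintegral P setT f - \sum_(i < q) fine (P (A i)) * f (p i)| <= e.
Proof.
move=> mf f0 e0 mA tA PU hA; set U := \big[setU/set0]_(i < q) A i in PU *.
have mU : measurable U by exact: bigsetU_measurable.
have mfE (D : set T) : measurable_fun D (EFin \o f).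
  by apply: measurable_funTS; exact/measurable_EFinP.
have fE0 y : (0 <= (f y)%:E)%E by rewrite lee_fin.
have PA i : P (A i) = (fine (P (A i)))%:E by rewrite fineK // fin_num_measure.
have intE : (\int[P]_y (f y)%:E = \sum_(i < q) \int[P]_(y in A i) (f y)%:E)%E.
  rewrite (ge0_negligible_integral (measurableC mU) measurableT (mfE _)) //; last by move=> y _; exact: fE0.
  have -> : [set: T] `\` ~` U = U by rewrite setDE setTI setCK.
  rewrite /U -(big_mkord predT A) ge0_integral_bigsetU ?iota_uniq //.
  - by rewrite -(big_mkord predT (fun i => \int[P]_(y in A i) (f y)%:E)%E).
  - exact: sub_trivIset tA.
  - by move=> y _; exact: fE0.
(* Nonnegativity and the upper bound [h1] show that the integral over a cell is finite, which
   provides the real number [r]. *)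
have bound i : exists r : R, (\int[P]_(y in A i) (f y)%:E = r%:E)%E /\
    `|r - fine (P (A i)) * f (p i)| <= e * fine (P (A i)).
  have a0 : 0 <= fine (P (A i)) by rewrite fine_ge0.
  have h1 : (\int[P]_(y in A i) (f y)%:E <= ((f (p i) + e) * fine (P (A i)))%:E)%E.
    rewrite EFinM -PA -integral_cst //; apply: ge0_le_integral => //.
    by move=> y /hA; rewrite ler_norml lee_fin => /andP[_]; rewrite lerBlDl.
  have h2 : ((f (p i) * fine (P (A i)))%:E <=
      \int[P]_(y in A i) (f y)%:E + (e * fine (P (A i)))%:E)%E.
    rewrite !EFinM -PA -!integral_cst // -ge0_integralD //.
    apply: ge0_le_integral => //.
    - by move=> y _; rewrite lee_fin.
    - by apply: emeasurable_funD => //; exact: measurable_cst.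
    - by move=> y /hA; rewrite ler_norml -EFinD lee_fin => /andP[+ _]; rewrite lerBrDl lerBlDr.
  have h0 : (0 <= \int[P]_(y in A i) (f y)%:E)%E by exact: integral_ge0.
  move: h0 h1 h2; case: (\int[P]_(y in A i) _)%E => [r| |] // _.
  rewrite -EFinD !lee_fin => h1 h2; exists r; split => //.
  by rewrite ler_norml; apply/andP; split; lra.
have [r rP] := choice bound.
have -> : Rintegral P setT f = \sum_(i < q) r i.
  rewrite /Rintegral intE; under eq_bigr => i _ do rewrite (rP i).1.
  by rewrite sumEFin.
rewrite -sumrB; apply: le_trans (ler_norm_sum _ _ _) _.
apply: le_trans (_ : \sum_(i < q) e * fine (P (A i)) <= _).
  by apply: ler_sum => i _; exact: (rP i).2.
rewrite -mulr_sumr ler_piMr // -lee_fin -sumEFin.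
under eq_bigr => i _ do rewrite -PA.
rewrite -measure_semi_additive_ord_I //; first exact: probability_le1.
exact: sub_trivIset tA.
Qed.

Lemma exists_discrete_probability (mu : seq (R * T)) :
  (forall p, p \in [seq p.1 | p <- mu] -> 0 <= p) -> \sum_(p <- mu) p.1 = 1 ->
  exists tau : probability T R,
    (forall B : set T, (forall i x0, (i < size mu)%N -> ~ B (nth x0 mu i).2) -> tau B = 0%E) /\
    (forall f : T -> R, measurable_fun setT f -> (forall y, 0 <= f y) ->
       Rintegral tau setT f = \sum_(p <- mu) p.1 * f p.2).
Proof.
move=> mu0 mu1.
(* Only the point of [x0] is used, as a default for [nth]; with default weight zero, all weights are
   nonnegative, also beyond the end of [mu]. *)
have [x0] : exists x0, x0 = head (0, point) mu by eexists.
move=> _.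
have w0 i : 0 <= (nth (0, x0.2) mu i).1.
  case: (ltnP i (size mu)) => hi; last by rewrite nth_default.
  by apply: mu0; apply/mapP; exists (nth (0, x0.2) mu i); rewrite ?mem_nth.
pose m (i : nat) : {measure set T -> \bar R} :=
  mscale (NngNum (w0 i)) (dirac (nth (0, x0.2) mu i).2).
have mE k (B : set T) : m k B =
    ((nth (0%R, x0.2) mu k).1%:E * \d_((nth (0%R, x0.2) mu k).2) B)%E by [].
pose M := msum m (size mu).
have MT : M setT = 1%E.
  rewrite /M /msum.
  have -> : (\sum_(k < size mu) m k setT)%E = (\sum_(k < size mu) (nth (0%R, x0.2) mu k).1%:E)%E.
    by apply: eq_bigr => k _; rewrite mE diracT mule1.
  by rewrite sumEFin; congr (_%:E); rewrite -[RHS]mu1 (big_nth (0, x0.2)) big_mkord.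
pose tau : probability T R := HB.pack M (Measure_isProbability.Build _ _ _ M MT).
exists tau; split.
  move=> B hB; rewrite /tau /= /M /msum big1 // => k _.
  by rewrite mE diracE memNset ?mule0 //; exact: hB.
move=> f mf f0.
have mfE : measurable_fun setT (EFin \o f) by exact/measurable_EFinP.
have fE0 y : (0 <= (f y)%:E)%E by rewrite lee_fin.
have step k : (\int[m k]_y (f y)%:E =
    ((nth (0%R, x0.2) mu k).1 * f (nth (0%R, x0.2) mu k).2)%:E)%E.
  rewrite /m ge0_integral_mscale //.
  by rewrite integral_dirac // diracT mul1e EFinM.
rewrite /Rintegral /tau /= ge0_integral_measure_sum //.
rewrite (eq_bigr _ (fun (k : 'I_(size mu)) _ => step k)).
by rewrite sumEFin /= (big_nth (0, x0.2)) big_mkord.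
Qed.

End Discretization.

Section Sphere.
Variables (R : realType) (d : nat).

Lemma open_borelR (U : set 'rV[R]_d.+1) : open U -> measurable (U : set (borelR R d)).
Proof. by move=> oU; apply: sub_sigma_algebra. Qed.

Lemma measurable_norm_dot (x : 'rV[R]_d.+1) :
  measurable_fun setT (fun y : borelR R d => `|dot x y|).
Proof.
move=> _; apply: (measurability _ (RGenOpens.measurableE R)) => //.
move=> _ [_ [a [b ->] <-]]; rewrite setTI.
apply: open_borelR; apply: open_comp; last exact: interval_open.
move=> y _; apply: (@continuous_comp _ _ _ (dot x) (fun r : R => `|r|)).
  exact: continuous_dot.
exact: norm_continuous.
Qed.

Lemma compact_sphere : compact [set x : 'rV[R]_d.+1 | dot x x = 1].
Proof.
have box := @rV_compact R d.+1 (fun=> `[(-1 : R), 1]%classic) (fun _ => @segment_compact _ _ _).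
apply: (subclosed_compact _ box).
  apply: (@preimage_closed _ _ (fun v : 'rV[R]_d.+1 => dot v v) [set r | r = 1]).
    by move=> v _; exact: continuous_dot2.
  exact: closed_eq.
by move=> x x1 i /=; rewrite in_itv /= -ler_norml; exact: unit_coord_le1.
Qed.

(** By compactness, finitely many balls centred on the sphere cover it; made disjoint, they give the
    atoms their masses. Balls are taken in the maximum norm, hence the radius [e / d.+1]. *)
Lemma sphere_discretization (tau : probability (borelR R d) R) (e : R) :
  0 < e -> tau (~` sphere R d) = 0%E ->
  exists mu : seq (R * 'rV[R]_d.+1), sphere_weights mu /\
    forall x, dot x x = 1 ->
      `|Rintegral tau setT (fun y => `|dot x y|) - potential mu x| <= e.
Proof.
move=> e0 tS; pose r := e / d.+1%:R.
have r0 : 0 < r by rewrite divr_gt0 // ltr0n.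
pose S := [set x : 'rV[R]_d.+1 | dot x x = 1].
have := compact_sphere; rewrite compact_cover => cS.
have [|x Sx|D' D'S D'cov] := cS 'rV[R]_d.+1 S (fun p => ball p r).
- by move=> p _; exact: ball_open.
- by exists x => //; exact: ballxx.
pose s : seq 'rV[R]_d.+1 := enum_fset D'; pose q := size s.
pose p i := nth 0 s i.
have pS i : (i < q)%N -> dot (p i) (p i) = 1.
  move=> iq; have pD : p i \in D' by apply: mem_nth.
  by have := D'S _ pD; rewrite inE.
pose B i : set (borelR R d) := if (i < q)%N then ball (p i) r else set0.
have mB i : measurable (B i).
  by rewrite /B; case: ifP => // _; apply: open_borelR; exact: ball_open.
pose U := \big[setU/set0]_(i < q) seqDU B i.
have mU : measurable U by apply: bigsetU_measurable => i _; exact: seqDU_measurable.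
have SU : S `<=` U.
  move=> x /D'cov [z zD' zx]; rewrite /U -bigsetU_seqDU -bigcup_mkord.
  exists (index z s); first by rewrite /= index_mem.
  by rewrite /B index_mem zD' /p nth_index.
have oS : open (~` S : set 'rV[R]_d.+1).
  by apply: closed_openC; apply: compact_closed; [exact: norm_hausdorff|exact: compact_sphere].
have tU0 : tau (~` U) = 0%E.
  apply: (@subset_measure0 _ _ _ tau _ (~` S)) => //.
  - exact: measurableC.
  - exact: open_borelR.
  - exact: subsetC.
have tA : trivIset setT (seqDU B) by exact: trivIset_seqDU.
have mA i : measurable (seqDU B i) by exact: seqDU_measurable.
pose a i := fine (tau (seqDU B i)).
pose mu := [seq (a i, p i) | i <- index_iota 0 q].
have potE (f : 'rV[R]_d.+1 -> R) : \sum_(z <- mu) z.1 * f z.2 = \sum_(i < q) a i * f (p i).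
  by rewrite big_map big_mkord.
exists mu; split.
  split=> [z /mapP[i]|].
    rewrite mem_index_iota /= => iq -> /=; split; first by rewrite fine_ge0.
    exact: pS.
  have := potE (fun=> 1); under eq_bigr do rewrite mulr1; move=> ->.
  under eq_bigr do rewrite mulr1.
  have : (\sum_(i < q) tau (seqDU B i) = 1)%E.
    rewrite -measure_semi_additive_ord_I //; last exact: sub_trivIset tA.
    have := probability_setC tau (measurableC mU).
    by rewrite tU0 sube0 setCK.
  have tE i : tau (seqDU B i) = (a i)%:E by rewrite /a fineK // fin_num_measure.
  rewrite (eq_bigr _ (fun (i : 'I_q) _ => tE i)).
  by rewrite sumEFin => -[].
move=> x x1; rewrite /potential (potE (fun y => `|dot x y|)).
apply: (@Rintegral_step_approx _ (borelR R d) R tau (fun y => `|dot x y|) (seqDU B) p q e) => //.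
- exact: measurable_norm_dot.
- exact: ltW.
- move=> i y [+ _]; rewrite /B; case: ifP => // _ [_ py].
  apply: le_trans (ler_dist_dist _ _) _.
  rewrite -dotBr dotC -[e](@divfK _ d.+1%:R) ?pnatr_eq0 // mulrC.
  apply: dot_le_coord => [l|l]; last exact: unit_coord_le1.
  by rewrite !mxE distrC; apply: ltW; exact: py.
Qed.

End Sphere.

Theorem theorem1 (R : realType) (d : nat) (hd : (1 <= d)%N) :
  exists C : R,
  forall (n : nat), (1 <= n)%N ->
  forall (tau : probability (borelR R d) R),
    tau (~` sphere R d) = 0%E ->
    exists (tau' : probability (borelR R d) R) (P : seq (vec R d)),
      [/\ (size P <= n)%N,
          (forall p, p \in P -> sphere R d p),
          tau' (~` [set y | y \in P]) = 0%E &
          forall x : vec R d, sphere R d x ->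
            `| Rintegral tau setT (fun y => `|dotp x y|)
               - Rintegral tau' setT (fun y => `|dotp x y|) |
            <= C * (n%:R `^ (- (1 / 2 + 3 / (2 * d%:R))))].
Proof.
have [C HC] := sparsification R hd.
(* The [1] pays for discretising [tau] with accuracy [n] to the power [- rate]. *)
exists (1 + C) => n n0 tau tS.
have T0 : 0 < n%:R `^ (- rate R d) by rewrite powR_gt0 // ltr0n.
have [mu [muP mu_tau]] := sphere_discretization T0 tS.
have [mu' [[mu'P mu'1] smu' mu_mu']] := HC n mu n0 muP.
have [|tau' [tau'0 tau'I]] := @exists_discrete_probability _ (borelR R d) R mu' _ mu'1.
  by move=> _ /mapP[z /mu'P[z0 _] ->].
exists tau', [seq z.2 | z <- mu']; split.
- by rewrite size_map.
- by move=> _ /mapP[z /mu'P[_ z1] ->].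
- apply: tau'0 => i x0 iq /=; apply.
  by apply/mapP; exists (nth x0 mu' i) => //; exact: mem_nth.
- move=> x x1; rewrite (tau'I (fun y => `|dotp x y|)) //; last exact: measurable_norm_dot.
  rewrite -(subrK (potential mu x) (Rintegral _ _ _)) -addrA.
  apply: le_trans (ler_normD _ _) _; rewrite mulrDl mul1r.
  by apply: lerD; [exact: mu_tau|exact: mu_mu'].
Qed.
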